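(* Let $k\geq1$ and let $X\subseteq\omega$ be $2$-random. Then for every computable sequence $\langle f_i:i\in\omega\rangle$ of $k$-bounded colorings $f_i:[\omega]^2\to\omega$ there is an $X$-computable sequence $\langle S_i:i\in\omega\rangle$ such that each $S_i$ is an infinite rainbow for $f_i$.
   Context: A coloring $f:[\omega]^n\to\omega$ is $k$-bounded if each color is assigned to at most $k$ many $\vec x\in[\omega]^n$. A set $S$ is a rainbow for $f$ if $f$ is injective on $[S]^n$. A set is $2$-random if it is Martin-Löf random relative to $\emptyset'$. *)

(* Defs.v *)
From Stdlib Require Import Arith List.
Import ListNotations.

Inductive code : Type :=
| CZero : code
| CSucc : code
| CProj : nat -> code
| COracle : code
| CComp : code -> list code -> code
| CPrimRec : code -> code -> code
| CMu : code -> code.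

Inductive eval (A : nat -> Prop) : code -> list nat -> nat -> Prop :=
| ev_zero : forall args, eval A CZero args 0
| ev_succ : forall x args, eval A CSucc (x :: args) (S x)
| ev_proj : forall i args, eval A (CProj i) args (nth i args 0)
| ev_oracle_in : forall x args, A x -> eval A COracle (x :: args) 1
| ev_oracle_out : forall x args, ~ A x -> eval A COracle (x :: args) 0
| ev_comp : forall f gs args vs v,
    eval_list A gs args vs -> eval A f vs v -> eval A (CComp f gs) args v
| ev_prec_0 : forall f g args v,
    eval A f args v -> eval A (CPrimRec f g) (0 :: args) v
| ev_prec_S : forall f g n args w v,
    eval A (CPrimRec f g) (n :: args) w ->
    eval A g (n :: w :: args) v ->
    eval A (CPrimRec f g) (S n :: args) v
| ev_mu : forall f args n,
    eval A f (n :: args) 0 ->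
    (forall m, m < n -> exists v, v <> 0 /\ eval A f (m :: args) v) ->
    eval A (CMu f) args n
with eval_list (A : nat -> Prop) : list code -> list nat -> list nat -> Prop :=
| evl_nil : forall args, eval_list A [] args []
| evl_cons : forall g gs args v vs,
    eval A g args v -> eval_list A gs args vs ->
    eval_list A (g :: gs) args (v :: vs).

Definition cpair (x y : nat) : nat := (x + y) * (x + y + 1) / 2 + y.

Fixpoint enc (c : code) : nat :=
  match c with
  | CZero => cpair 0 0
  | CSucc => cpair 1 0
  | CProj i => cpair 2 i
  | COracle => cpair 3 0
  | CComp f gs =>
      cpair 4 (cpair (enc f)
        ((fix encl (l : list code) : nat :=
            match l with
            | [] => 0
            | g :: l' => S (cpair (enc g) (encl l'))
            end) gs))
  | CPrimRec f g => cpair 5 (cpair (enc f) (enc g))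
  | CMu f => cpair 6 (enc f)
  end.

Definition empty_set : nat -> Prop := fun _ => False.

Definition halting_set : nat -> Prop :=
  fun e => exists c, enc c = e /\ exists v, eval empty_set c [e] v.

Definition ce_in (A : nat -> Prop) (W : nat -> Prop) : Prop :=
  exists c, forall n, W n <-> exists v, eval A c [n] v.

Fixpoint str_code (s : list bool) : nat :=
  match s with
  | [] => 0
  | b :: s' => S (2 * str_code s' + (if b then 1 else 0))
  end.

Definition is_prefix (s t : list bool) : Prop := exists u, t = s ++ u.

Definition prefix_free (F : list (list bool)) : Prop :=
  forall s t, In s F -> In t F -> is_prefix s t -> s = t.

Definition prefix_of_set (s : list bool) (X : nat -> Prop) : Prop :=
  forall i, i < length s -> (nth i s false = true <-> X i).

(* mu([U]) <= 2^-n, written out: every finite prefix-free F subset of U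
   has sum_{s in F} 2^-|s| <= 2^-n (cleared of denominators by 2^L). *)
Definition measure_le_pow2 (U : list bool -> Prop) (n : nat) : Prop :=
  forall (F : list (list bool)) (L : nat),
    NoDup F -> (forall s, In s F -> U s) -> prefix_free F ->
    (forall s, In s F -> length s <= L) ->
    2 ^ n * fold_right Nat.add 0 (map (fun s => 2 ^ (L - length s)) F) <= 2 ^ L.

Definition ML_test_in (A : nat -> Prop) (U : nat -> list bool -> Prop) : Prop :=
  ce_in A (fun m => exists n s, m = cpair n (str_code s) /\ U n s) /\
  (forall n, measure_le_pow2 (U n) n).

Definition ML_random_in (A : nat -> Prop) (X : nat -> Prop) : Prop :=
  forall U, ML_test_in A U -> exists n, forall s, U n s -> ~ prefix_of_set s X.

Definition two_random (X : nat -> Prop) : Prop := ML_random_in halting_set X.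

(* f x y is the color of {x,y} for x < y (values for x >= y are ignored). *)
Definition k_bounded (k : nat) (f : nat -> nat -> nat) : Prop :=
  forall (col : nat) (P : list (nat * nat)), NoDup P ->
    (forall p, In p P -> fst p < snd p /\ f (fst p) (snd p) = col) ->
    length P <= k.

Definition rainbow (f : nat -> nat -> nat) (S : nat -> Prop) : Prop :=
  forall x1 y1 x2 y2, S x1 -> S y1 -> S x2 -> S y2 ->
    x1 < y1 -> x2 < y2 -> f x1 y1 = f x2 y2 -> x1 = x2 /\ y1 = y2.

Definition infinite_set (S : nat -> Prop) : Prop :=
  forall m, exists x, m <= x /\ S x.

Definition computable_coloring_seq (F : nat -> nat -> nat -> nat) : Prop :=
  exists c, forall i x y, eval empty_set c [i; x; y] (F i x y).

Definition set_seq_computable_in (A : nat -> Prop) (S : nat -> nat -> Prop) : Prop :=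
  exists c, forall i x,
    (S i x -> eval A c [i; x] 1) /\ (~ S i x -> eval A c [i; x] 0).

(* Main.v *)
(** A number [z] above a finite rainbow [M] is viable for [M] when [M + {z}] is again a
    rainbow; call [M] dead when only finitely many numbers are viable for it.
    If [M] is not dead, then at most [k * |M|] of its viable elements [a] make
    [M + {a}] dead: otherwise, for some large viable [z], more than [k * |M|] pairs
    [(a, z)] would share their color with one of the [|M|] pairs [(x, z)], [x] in [M].
    Hence if each step picks one of the first [2 ^ p] viable elements, using [p] fresh
    bits of [X] with [p] growing fast enough, the probability of ever reaching a dead set
    is as small as we like, and summable over the colorings.  Being dead is c.e. in the
    halting problem, so these failure events form a Martin-Löf test relative to it, and a
    2-random [X] avoids one of its components; along that [X] the construction never
    stops and computes the rainbows.

    Finite sets are coded by the numbers whose binary digits are their characteristic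
    functions, so that the whole history of a construction is its current set. *)
Require Import Defs.
From Stdlib Require Import Arith List Lia Classical ClassicalEpsilon.
Import ListNotations.

(** * Oracle computations *)

(** Codes occur nested in a list under [CComp]; the inner fixpoint supplies the induction hypotheses
    for that list. *)
Fixpoint code_Forall_ind (P : code -> Prop) (hzero : P CZero) (hsucc : P CSucc)
  (hproj : forall i, P (CProj i)) (horacle : P COracle)
  (hcomp : forall f gs, P f -> Forall P gs -> P (CComp f gs))
  (hprec : forall f g, P f -> P g -> P (CPrimRec f g))
  (hmu : forall f, P f -> P (CMu f)) (c : code) : P c :=
  let rec := code_Forall_ind P hzero hsucc hproj horacle hcomp hprec hmu in
  match c with
  | CZero => hzero
  | CSucc => hsucc
  | CProj i => hproj i
  | COracle => horacle
  | CComp f gs =>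
      hcomp f gs (rec f)
        ((fix go (l : list code) : Forall P l :=
            match l with
            | [] => Forall_nil P
            | g :: l' => Forall_cons g (rec g) (go l')
            end) gs)
  | CPrimRec f g => hprec f g (rec f) (rec g)
  | CMu f => hmu f (rec f)
  end.

Lemma eval_deterministic (A : nat -> Prop) (c : code) :
  forall args v v', eval A c args v -> eval A c args v' -> v = v'.
Proof.
  induction c as [| | | |f gs IHf IHgs|f g IHf IHg|f IHf] using code_Forall_ind;
    intros args v v' H H'.
  1-4: inversion H; subst; inversion H'; subst; congruence.
  - inversion H as [| | | | |? ? ? vs ? Hl Hf| | |]; subst.
    inversion H' as [| | | | |? ? ? vs' ? Hl' Hf'| | |]; subst.
    assert (vs = vs') as <-; [|eauto].
    clear - IHgs Hl Hl'. revert vs vs' Hl Hl'.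
    induction IHgs as [|g gs Hg _ IH]; intros vs vs' Hl Hl';
      inversion Hl; subst; inversion Hl'; subst; f_equal; eauto.
  - destruct args as [|n args]; [inversion H|].
    revert v v' H H'; induction n as [|n IHn]; intros v v' H H';
      inversion H; subst; inversion H'; subst; [eauto|].
    match goal with
    | H1 : eval A (CPrimRec f g) (n :: args) ?a,
      H2 : eval A (CPrimRec f g) (n :: args) ?b |- _ =>
        assert (a = b) as <- by (eapply IHn; eassumption)
    end.
    eauto.
  - inversion H as [| | | | | | | |? ? ? H0 Hlt]; subst.
    inversion H' as [| | | | | | | |? ? ? H0' Hlt']; subst.
    (* If two searches disagreed, the body would take both the value 0 and a nonzero value at the
       smaller result. *)
    destruct (Nat.lt_trichotomy v v') as [L|[L|L]]; [|exact L|].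
    + destruct (Hlt' _ L) as (u & Hu & E). destruct Hu. eauto.
    + destruct (Hlt _ L) as (u & Hu & E). destruct Hu. eauto.
Qed.

(** Queries to the empty oracle are always answered 0, so they can be replaced by [CZero]; this
    carries computable colorings over to any oracle. *)
Fixpoint strip_oracle (c : code) : code :=
  match c with
  | COracle => CZero
  | CComp f gs => CComp (strip_oracle f) (map strip_oracle gs)
  | CPrimRec f g => CPrimRec (strip_oracle f) (strip_oracle g)
  | CMu f => CMu (strip_oracle f)
  | _ => c
  end.

Lemma eval_strip_oracle (A : nat -> Prop) (c : code) :
  forall args v, eval empty_set c args v -> eval A (strip_oracle c) args v.
Proof.
  induction c as [| | | |f gs IHf IHgs|f g IHf IHg|f IHf] using code_Forall_ind;
    intros args v H; simpl.
  - inversion H; constructor.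
  - inversion H; constructor.
  - inversion H; constructor.
  - inversion H as [| | |? ? []| | | | |]; constructor.
  - inversion H as [| | | | |? ? ? vs ? Hl Hf| | |]; subst.
    apply ev_comp with vs; [|auto].
    clear - IHgs Hl. revert vs Hl.
    induction IHgs as [|g gs Hg _ IH]; intros vs Hl; inversion Hl; subst;
      constructor; auto.
  - destruct args as [|n args]; [inversion H|].
    revert v H; induction n as [|n IHn]; intros v H; inversion H; subst.
    + constructor; auto.
    + econstructor; eauto.
  - inversion H as [| | | | | | | |? ? ? H0 Hlt]; subst.
    constructor; [auto|]. intros m Hm. destruct (Hlt m Hm) as (u & Hu & E). eauto.
Qed.

(** Predicates are handled through their classical 0-1 values: being decidable relative to [A] means
    that [ind] of the predicate is computable relative to [A]. *)
Definition ind (P : Prop) : nat := if excluded_middle_informative P then 1 else 0.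

Lemma ind_true (P : Prop) : P -> ind P = 1.
Proof. unfold ind; destruct excluded_middle_informative; tauto. Qed.

Lemma ind_false (P : Prop) : ~ P -> ind P = 0.
Proof. unfold ind; destruct excluded_middle_informative; tauto. Qed.

Lemma ind_cases (P : Prop) : P /\ ind P = 1 \/ ~ P /\ ind P = 0.
Proof. destruct (classic P); [left|right]; auto using ind_true, ind_false. Qed.

Lemma ind_iff (P Q : Prop) : (P <-> Q) -> ind P = ind Q.
Proof. destruct (ind_cases P), (ind_cases Q); intuition congruence. Qed.

Fixpoint bsum (n : nat) (f : nat -> nat) : nat :=
  match n with
  | 0 => 0
  | S m => f m + bsum m f
  end.

Definition computable (A : nat -> Prop) (n : nat) (f : list nat -> nat) : Prop :=
  exists c, forall l, length l = n -> eval A c l (f l).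

Definition computable1 A (g : nat -> nat) : Prop :=
  computable A 1 (fun l => g (hd 0 l)).
Definition computable2 A (g : nat -> nat -> nat) : Prop :=
  computable A 2 (fun l => g (hd 0 l) (hd 0 (tl l))).
Definition computable3 A (g : nat -> nat -> nat -> nat) : Prop :=
  computable A 3 (fun l => g (hd 0 l) (hd 0 (tl l)) (hd 0 (tl (tl l)))).
Definition computable4 A (g : nat -> nat -> nat -> nat -> nat) : Prop :=
  computable A 4 (fun l => g (hd 0 l) (hd 0 (tl l)) (hd 0 (tl (tl l)))
                             (hd 0 (tl (tl (tl l))))).

Lemma computable_ext A n f g :
  (forall l, f l = g l) -> computable A n f -> computable A n g.
Proof. intros E [c H]. exists c. intros l Hl. rewrite <- E. auto. Qed.

Lemma computable_const A n v : computable A n (fun _ => v).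
Proof.
  induction v as [|v [c IH]].
  - exists CZero. constructor.
  - exists (CComp CSucc [c]). intros l Hl.
    apply ev_comp with [v]; repeat constructor; auto.
Qed.

Lemma hd_iter_tl i (l : list nat) : hd 0 (Nat.iter i (@tl nat) l) = nth i l 0.
Proof.
  revert l; induction i as [|i IH]; intros l; [destruct l; reflexivity|].
  rewrite Nat.iter_succ_r, IH. destruct l; simpl; [now destruct i|reflexivity].
Qed.

(* For a numeral [i], unification turns [Nat.iter i tl l] into [tl (... (tl l))],
   the form in which variables occur in goals. *)
Lemma computable_var A n i : computable A n (fun l => hd 0 (Nat.iter i (@tl nat) l)).
Proof. exists (CProj i). intros l _. rewrite hd_iter_tl. constructor. Qed.

Lemma computable_comp1 A n g f : computable1 A g -> computable A n f ->
  computable A n (fun l => g (f l)).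
Proof.
  intros [c H] [c1 H1]. exists (CComp c [c1]). intros l Hl.
  apply ev_comp with [f l]; [|apply (H [f l]); reflexivity].
  repeat constructor; auto.
Qed.

Lemma computable_comp2 A n g f1 f2 : computable2 A g ->
  computable A n f1 -> computable A n f2 ->
  computable A n (fun l => g (f1 l) (f2 l)).
Proof.
  intros [c H] [c1 H1] [c2 H2]. exists (CComp c [c1; c2]). intros l Hl.
  apply ev_comp with [f1 l; f2 l]; [|apply (H [f1 l; f2 l]); reflexivity].
  repeat constructor; auto.
Qed.

Lemma computable_comp3 A n g f1 f2 f3 : computable3 A g ->
  computable A n f1 -> computable A n f2 -> computable A n f3 ->
  computable A n (fun l => g (f1 l) (f2 l) (f3 l)).
Proof.
  intros [c H] [c1 H1] [c2 H2] [c3 H3]. exists (CComp c [c1; c2; c3]). intros l Hl.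
  apply ev_comp with [f1 l; f2 l; f3 l];
    [|apply (H [f1 l; f2 l; f3 l]); reflexivity].
  repeat constructor; auto.
Qed.

Lemma computable_comp4 A n g f1 f2 f3 f4 : computable4 A g ->
  computable A n f1 -> computable A n f2 -> computable A n f3 -> computable A n f4 ->
  computable A n (fun l => g (f1 l) (f2 l) (f3 l) (f4 l)).
Proof.
  intros [c H] [c1 H1] [c2 H2] [c3 H3] [c4 H4].
  exists (CComp c [c1; c2; c3; c4]). intros l Hl.
  apply ev_comp with [f1 l; f2 l; f3 l; f4 l];
    [|apply (H [f1 l; f2 l; f3 l; f4 l]); reflexivity].
  repeat constructor; auto.
Qed.

Lemma eval_list_projections A p l :
  eval_list A (map CProj (seq (length p) (length l))) (p ++ l) l.
Proof.
  revert p; induction l as [|x l IH]; intros p; simpl; [constructor|].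
  constructor.
  - replace x with (nth (length p) (p ++ x :: l) 0) at 2; [constructor|].
    rewrite app_nth2, Nat.sub_diag; auto.
  - specialize (IH (p ++ [x])). rewrite <- app_assoc, length_app, Nat.add_1_r in IH.
    exact IH.
Qed.

Lemma computable_iter A n g f h :
  computable1 A g -> computable A n f -> computable A n h ->
  computable A n (fun l => Nat.iter (h l) g (f l)).
Proof.
  intros [cg Hg] [cf Hf] [ch Hh].
  exists (CComp (CPrimRec cf (CComp cg [CProj 1])) (ch :: map CProj (seq 0 n))).
  intros l Hl. apply ev_comp with (h l :: l).
  - constructor; [auto|]. rewrite <- Hl. apply (eval_list_projections A []).
  - generalize (h l) as m. induction m as [|m IH]; simpl.
    + constructor; auto.
    + econstructor; [exact IH|].
      apply ev_comp with [Nat.iter m g (f l)]; [|apply (Hg [_]); reflexivity].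
      repeat constructor.
Qed.

(** * Arithmetic, connectives and bounded quantifiers *)

Lemma computable_S A : computable1 A S.
Proof. exists CSucc. intros [|x [|]]; try discriminate. constructor. Qed.

Lemma computable_pred A : computable1 A Nat.pred.
Proof.
  exists (CPrimRec CZero (CProj 0)). intros [|x [|]]; try discriminate. intros _. simpl.
  assert (H : forall y, eval A (CPrimRec CZero (CProj 0)) [y] (Nat.pred y)); [|apply H].
  induction y as [|y IH]; [repeat constructor|].
  econstructor; [exact IH|]. apply (ev_proj A 0 [y; Nat.pred y]).
Qed.

Create HintDb computable.
#[export] Hint Resolve computable_S computable_pred : computable.

Lemma computable_add A : computable2 A Nat.add.
Proof.
  eapply computable_ext with (f := fun l => Nat.iter (hd 0 l) S (hd 0 (tl l))).
  - intros l. generalize (hd 0 l) as m. induction m; simpl; auto.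
  - apply computable_iter; auto with computable;
      [apply (computable_var A 2 1)|apply (computable_var A 2 0)].
Qed.

Lemma computable_sub A : computable2 A Nat.sub.
Proof.
  eapply computable_ext with (f := fun l => Nat.iter (hd 0 (tl l)) Nat.pred (hd 0 l)).
  - intros l. generalize (hd 0 (tl l)) as m. induction m; simpl; lia.
  - apply computable_iter; auto with computable;
      [apply (computable_var A 2 0)|apply (computable_var A 2 1)].
Qed.
#[export] Hint Resolve computable_add computable_sub : computable.

Lemma computable_bsum A n (h : list nat -> nat) (f : list nat -> nat -> nat) :
  computable A n h -> computable A (S n) (fun l => f (tl l) (hd 0 l)) ->
  computable A n (fun l => bsum (h l) (f l)).
Proof.
  intros [ch Hh] [cf Hf]. destruct (computable_add A) as [ca Ha].
  (* The recursion step sees the counter, the partial sum, then [l]. The summand gets projection 0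
     and those from 2 on, skipping the partial sum. *)
  exists (CComp (CPrimRec CZero
      (CComp ca [CComp cf (CProj 0 :: map CProj (seq 2 n)); CProj 1]))
    (ch :: map CProj (seq 0 n))).
  intros l Hl. apply ev_comp with (h l :: l).
  - constructor; [auto|]. rewrite <- Hl. apply (eval_list_projections A []).
  - generalize (h l) as m. induction m as [|m IH]; simpl.
    + repeat constructor.
    + econstructor; [exact IH|].
      apply ev_comp with [f l m; bsum m (f l)]; [|apply (Ha [_; _]); reflexivity].
      constructor; [|constructor; [|constructor]].
      * apply ev_comp with (m :: l); [|apply (Hf (m :: l)); simpl; auto].
        constructor; [apply (ev_proj A 0 (m :: bsum m (f l) :: l))|].
        rewrite <- Hl. apply (eval_list_projections A [m; bsum m (f l)]).
      * apply (ev_proj A 1 (m :: bsum m (f l) :: l)).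
Qed.

Lemma computable_oracle A : computable1 A (fun x => ind (A x)).
Proof.
  exists COracle. intros [|x [|]]; try discriminate. intros _. simpl.
  destruct (ind_cases (A x)) as [[H ->]|[H ->]]; constructor; auto.
Qed.

Lemma computable_ind_le A n f g : computable A n f -> computable A n g ->
  computable A n (fun l => ind (f l <= g l)).
Proof.
  intros Hf Hg. eapply computable_ext with (f := fun l => 1 - (f l - g l)).
  - intros l. destruct (ind_cases (f l <= g l)) as [[H ->]|[H ->]]; lia.
  - apply computable_comp2; auto with computable; [apply computable_const|].
    apply computable_comp2; auto with computable.
Qed.

Lemma computable_ind_lt A n f g : computable A n f -> computable A n g ->
  computable A n (fun l => ind (f l < g l)).
Proof.
  intros Hf Hg. apply (computable_ind_le A n (fun l => S (f l)) g); auto.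
  apply computable_comp1; auto with computable.
Qed.

Lemma computable_ind_not A n P : computable A n (fun l => ind (P l)) ->
  computable A n (fun l => ind (~ P l)).
Proof.
  intros H. eapply computable_ext with (f := fun l => 1 - ind (P l)).
  - intros l. destruct (ind_cases (P l)) as [[H' ->]|[H' ->]].
    + now rewrite ind_false.
    + now rewrite ind_true.
  - apply computable_comp2; auto with computable; apply computable_const.
Qed.

Lemma computable_ind_imp A n P Q : computable A n (fun l => ind (P l)) ->
  computable A n (fun l => ind (Q l)) ->
  computable A n (fun l => ind (P l -> Q l)).
Proof.
  intros HP HQ. eapply computable_ext with (f := fun l => ind (ind (P l) <= ind (Q l))).
  - intros l. apply ind_iff.
    destruct (ind_cases (P l)) as [[? ->]|[? ->]], (ind_cases (Q l)) as [[? ->]|[? ->]];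
      split; intros; (lia || tauto).
  - apply computable_ind_le; auto.
Qed.

Lemma computable_ind_and A n P Q : computable A n (fun l => ind (P l)) ->
  computable A n (fun l => ind (Q l)) ->
  computable A n (fun l => ind (P l /\ Q l)).
Proof.
  intros HP HQ. eapply computable_ext with (f := fun l => ind (~ (P l -> ~ Q l))).
  - intros l. apply ind_iff. destruct (classic (P l)), (classic (Q l)); tauto.
  - apply computable_ind_not, computable_ind_imp; auto using computable_ind_not.
Qed.

Lemma computable_ind_eq A n f g : computable A n f -> computable A n g ->
  computable A n (fun l => ind (f l = g l)).
Proof.
  intros Hf Hg.
  eapply computable_ext with (f := fun l => ind (f l <= g l /\ g l <= f l)).
  - intros l. apply ind_iff. lia.
  - apply computable_ind_and; apply computable_ind_le; auto.
Qed.

Lemma bsum_ind_eq0 n (P : nat -> Prop) :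
  bsum n (fun x => ind (P x)) = 0 <-> forall x, x < n -> ~ P x.
Proof.
  induction n as [|n IH]; simpl; [split; intros; lia|].
  destruct (ind_cases (P n)) as [[H ->]|[H ->]].
  - split; [lia|]. intros H'. now destruct (H' n (Nat.lt_succ_diag_r n)).
  - simpl. rewrite IH. split; intros H' x Hx.
    + destruct (Nat.eq_dec x n) as [->|]; [auto|apply H'; lia].
    + apply H'; lia.
Qed.

Lemma computable_ind_forall A n h (P : list nat -> nat -> Prop) :
  computable A n h -> computable A (S n) (fun l => ind (P (tl l) (hd 0 l))) ->
  computable A n (fun l => ind (forall x, x < h l -> P l x)).
Proof.
  intros Hh HP.
  eapply computable_ext with
    (f := fun l => ind (bsum (h l) (fun x => ind (~ P l x)) = 0)).
  - intros l. apply ind_iff. rewrite bsum_ind_eq0.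
    split; intros H x Hx; specialize (H x Hx); tauto.
  - apply computable_ind_eq; [|apply computable_const].
    apply computable_bsum; auto using computable_ind_not.
Qed.

Lemma computable_ind_exists A n h (P : list nat -> nat -> Prop) :
  computable A n h -> computable A (S n) (fun l => ind (P (tl l) (hd 0 l))) ->
  computable A n (fun l => ind (exists x, x < h l /\ P l x)).
Proof.
  intros Hh HP.
  eapply computable_ext with (f := fun l => ind (~ forall x, x < h l -> ~ P l x)).
  - intros l. apply ind_iff. split.
    + intros H. apply not_all_ex_not in H as [x H]. exists x. tauto.
    + intros (x & Hx & H) H'. exact (H' x Hx H).
  - apply computable_ind_not, computable_ind_forall; auto.
    now apply computable_ind_not in HP.
Qed.

Ltac computable_var_tac :=
  match goal with
  | |- computable ?A ?n _ =>
      first [ exact (computable_var A n 0) | exact (computable_var A n 1)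
            | exact (computable_var A n 2) | exact (computable_var A n 3)
            | exact (computable_var A n 4) | exact (computable_var A n 5)
            | exact (computable_var A n 6) | exact (computable_var A n 7)
            | exact (computable_var A n 8) | exact (computable_var A n 9) ]
  end.

(** Quantifiers are recognized only when guarded by a bound, as in [x < h]; hence the guards in
    definitions such as [viable] and [run]. Applications are resolved by the hint database. *)
Ltac computable_step :=
  cbv beta;
  match goal with
  | |- computable ?A ?n (fun l => ?v) => exact (computable_const A n v)
  | |- computable _ _ (hd _) => computable_var_tac
  | |- computable _ _ (fun l => hd _ _) => computable_var_tac
  | |- computable ?A ?n (fun l => bsum (@?h l) (@?f l)) => apply (computable_bsum A n h f)
  | |- computable ?A ?n (fun l => ind (@?a l = @?b l)) => apply (computable_ind_eq A n a b)
  | |- computable ?A ?n (fun l => ind (@?a l < @?b l)) => apply (computable_ind_lt A n a b)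
  | |- computable ?A ?n (fun l => ind (@?a l <= @?b l)) => apply (computable_ind_le A n a b)
  | |- computable ?A ?n (fun l => ind (~ @?P l)) => apply (computable_ind_not A n P)
  | |- computable ?A ?n (fun l => ind (@?P l /\ @?Q l)) =>
      apply (computable_ind_and A n P Q)
  | |- computable ?A ?n (fun l => ind (exists x, x < @?h l /\ @?P l x)) =>
      apply (computable_ind_exists A n h P)
  | |- computable ?A ?n (fun l => ind (forall x, x < @?h l -> @?P l x)) =>
      apply (computable_ind_forall A n h P)
  | |- computable ?A ?n (fun l => ind (@?P l -> @?Q l)) =>
      apply (computable_ind_imp A n P Q)
  | |- computable ?A ?n (fun l => ind (?P (@?a l) (@?b l) (@?c l) (@?d l))) =>
      apply (computable_comp4 A n (fun x y z t => ind (P x y z t)) a b c d);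
        [solve [auto with computable]| | | | ]
  | |- computable ?A ?n (fun l => ind (?P (@?a l) (@?b l) (@?c l))) =>
      apply (computable_comp3 A n (fun x y z => ind (P x y z)) a b c);
        [solve [auto with computable]| | | ]
  | |- computable ?A ?n (fun l => ind (?P (@?a l) (@?b l))) =>
      apply (computable_comp2 A n (fun x y => ind (P x y)) a b);
        [solve [auto with computable]| | ]
  | |- computable ?A ?n (fun l => ind (?P (@?a l))) =>
      apply (computable_comp1 A n (fun x => ind (P x)) a);
        [solve [auto with computable]| ]
  | |- computable ?A ?n (fun l => ?g (@?a l) (@?b l) (@?c l) (@?d l)) =>
      apply (computable_comp4 A n g a b c d); [solve [auto with computable]| | | | ]
  | |- computable ?A ?n (fun l => ?g (@?a l) (@?b l) (@?c l)) =>
      apply (computable_comp3 A n g a b c); [solve [auto with computable]| | | ]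
  | |- computable ?A ?n (fun l => ?g (@?a l) (@?b l)) =>
      apply (computable_comp2 A n g a b); [solve [auto with computable]| | ]
  | |- computable ?A ?n (fun l => ?g (@?a l)) =>
      apply (computable_comp1 A n g a); [solve [auto with computable]| ]
  end.

Ltac prove_computable :=
  unfold computable1, computable2, computable3, computable4; repeat computable_step.

#[export] Hint Resolve computable_oracle : computable.

Lemma bsum_ext n f g : (forall x, x < n -> f x = g x) -> bsum n f = bsum n g.
Proof. induction n; simpl; intros H; [reflexivity|]. rewrite H, IHn; auto. Qed.

Lemma computable_mul A : computable2 A Nat.mul.
Proof.
  eapply computable_ext with (f := fun l => bsum (hd 0 l) (fun _ => hd 0 (tl l))).
  - intros l. generalize (hd 0 l) as m. induction m; simpl; auto.
  - prove_computable.
Qed.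
#[export] Hint Resolve computable_mul : computable.

Lemma computable_pow2 A : computable1 A (Nat.pow 2).
Proof.
  eapply computable_ext with (f := fun l => Nat.iter (hd 0 l) (fun x => 2 * x) 1).
  - intros l. generalize (hd 0 l) as m. induction m; simpl; auto.
  - apply computable_iter; prove_computable.
Qed.
#[export] Hint Resolve computable_pow2 : computable.

Lemma bsum_ind_lt n m : m <= n -> bsum n (fun x => ind (x < m)) = m.
Proof.
  intros H. assert (E : bsum n (fun x => ind (x < m)) = Nat.min n m); [|lia].
  clear H. induction n as [|n IH]; cbn [bsum]; [reflexivity|]. rewrite IH.
  destruct (ind_cases (n < m)) as [[? ->]|[? ->]]; lia.
Qed.

Lemma computable_div A : computable2 A Nat.div.
Proof.
  (* The quotient [a / b] counts the [x < a] with [S x * b <= a]; the guard [0 < b] gives division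
     by zero its value 0. *)
  eapply computable_ext with (f := fun l => bsum (hd 0 l)
    (fun x => ind (0 < hd 0 (tl l) /\ S x * hd 0 (tl l) <= hd 0 l))).
  - intros l. generalize (hd 0 l) as a, (hd 0 (tl l)) as b. intros a b.
    destruct (Nat.eq_0_gt_0_cases b) as [->|Hb].
    + simpl. apply bsum_ind_eq0. lia.
    + rewrite <- (bsum_ind_lt a (a / b)).
      * apply bsum_ext. intros x _. apply ind_iff. split.
        -- intros [_ H]. apply Nat.div_le_lower_bound; lia.
        -- intros H. split; [lia|]. pose proof (Nat.Div0.mul_div_le a b). nia.
      * apply Nat.Div0.div_le_upper_bound; nia.
  - prove_computable.
Qed.
#[export] Hint Resolve computable_div : computable.

Lemma computable_mod A : computable2 A Nat.modulo.
Proof.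
  eapply computable_ext with
    (f := fun l => hd 0 l - hd 0 (tl l) * (hd 0 l / hd 0 (tl l))).
  - intros l. symmetry. apply Nat.Div0.mod_eq.
  - prove_computable.
Qed.
#[export] Hint Resolve computable_mod : computable.

Lemma computable_cpair A : computable2 A cpair.
Proof. unfold cpair. prove_computable. Qed.
#[export] Hint Resolve computable_cpair : computable.

(** Serves both as a semidecision procedure and, where a zero is known to exist, as a total
    search. *)
Lemma eval_mu_total A n f :
  computable A (S n) f ->
  exists c, forall l, length l = n ->
    (forall t, f (t :: l) = 0 -> exists v, eval A c l v /\ f (v :: l) = 0) /\
    (forall v, eval A c l v -> f (v :: l) = 0).
Proof.
  intros [c Hc]. exists (CMu c). intros l Hl. split.
  (* [CMu] demands nonzero values everywhere below its result, so the argument descends to the least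
     zero. *)
  - intros t. induction t as [t IH] using lt_wf_ind. intros Ht.
    destruct (classic (exists s, s < t /\ f (s :: l) = 0)) as [(s & Hs & E)|H];
      [exact (IH s Hs E)|].
    exists t. split; [|exact Ht]. constructor.
    + rewrite <- Ht. apply Hc. simpl; auto.
    + intros m Hm. exists (f (m :: l)). split; [|apply Hc; simpl; auto].
      intros E. apply H. eauto.
  - intros v H. inversion H; subst.
    eapply eval_deterministic; [apply Hc; simpl; auto|assumption].
Qed.

(** * Injectivity of pairing and of program codes; parametrized halting queries *)

Lemma triangular_S s : S s * (S s + 1) / 2 = s * (s + 1) / 2 + S s.
Proof.
  replace (S s * (S s + 1)) with (s * (s + 1) + S s * 2) by nia.
  apply Nat.div_add. discriminate.
Qed.

Lemma triangular_le s t : s <= t -> s * (s + 1) / 2 <= t * (t + 1) / 2.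
Proof. intros H. apply Nat.Div0.div_le_mono. nia. Qed.

(** Pairs with sum [s] take values from the triangular number of [s] up to that number plus [s],
    which is below the next triangular number. So the value determines the sum, and then [y]. *)
Lemma cpair_inj x y x' y' : cpair x y = cpair x' y' -> x = x' /\ y = y'.
Proof.
  unfold cpair. intros H.
  assert (E : x + y = x' + y').
  { destruct (Nat.lt_trichotomy (x + y) (x' + y')) as [L|[L|L]]; [|exact L|];
      apply triangular_le in L; rewrite triangular_S in L; lia. }
  rewrite E in H. lia.
Qed.

Fixpoint enc_list (l : list code) : nat :=
  match l with
  | [] => 0
  | g :: l' => S (cpair (enc g) (enc_list l'))
  end.

Lemma enc_comp f gs : enc (CComp f gs) = cpair 4 (cpair (enc f) (enc_list gs)).
Proof. reflexivity. Qed.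

Lemma enc_inj c c' : enc c = enc c' -> c = c'.
Proof.
  revert c'.
  induction c as [| | | |f gs IHf IHgs|f g IHf IHg|f IHf] using code_Forall_ind;
    intros [| | | |f' gs'|f' g'|f'] H; rewrite ?enc_comp in H; cbn [enc] in H;
    apply cpair_inj in H as [H0 H]; try discriminate; try congruence.
  - apply cpair_inj in H as [Hf Hgs]. f_equal; [auto|].
    clear - IHgs Hgs. revert gs' Hgs.
    induction IHgs as [|g gs Hg _ IH]; intros [|g' gs'] H; try discriminate; [auto|].
    cbn [enc_list] in H. injection H as H. apply cpair_inj in H as [H1 H2].
    f_equal; auto.
  - apply cpair_inj in H as [Hf Hg]. f_equal; auto.
  - f_equal; auto.
Qed.

Fixpoint const_code (n : nat) : code :=
  match n with
  | 0 => CZero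
  | S m => CComp CSucc [const_code m]
  end.

Lemma eval_const_code A n args : eval A (const_code n) args n.
Proof.
  induction n as [|n IH]; simpl; [constructor|].
  apply ev_comp with [n]; repeat constructor; auto.
Qed.

(** Each iteration wraps one more [CSucc] around the code, on the level of code numbers; written as
    an iteration it is visibly computable. *)
Definition const_enc (n : nat) : nat :=
  Nat.iter n (fun r => cpair 4 (cpair (enc CSucc) (S (cpair r 0)))) (enc CZero).

Lemma const_enc_spec n : const_enc n = enc (const_code n).
Proof.
  unfold const_enc. induction n as [|n IH]; [reflexivity|].
  cbn [Nat.iter nat_rect const_code]. rewrite enc_comp. cbn [enc_list].
  unfold Nat.iter in IH. now rewrite IH.
Qed.

Lemma computable_const_enc A : computable1 A const_enc.
Proof. apply computable_iter; prove_computable. Qed.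
#[export] Hint Resolve computable_const_enc : computable.

(* The s-m-n theorem: the parameters are frozen into a code as constants. *)
Lemma halting_query (P : nat -> nat -> nat -> nat -> Prop) :
  computable4 empty_set (fun z a b c => ind (P z a b c)) ->
  exists h, (forall A, computable3 A h) /\
    forall a b c, halting_set (h a b c) <-> exists z, P z a b c.
Proof.
  intros HP.
  destruct (eval_mu_total empty_set 3 (fun l => 1 -
    ind (P (hd 0 l) (hd 0 (tl l)) (hd 0 (tl (tl l))) (hd 0 (tl (tl (tl l)))))))
    as [d Hd].
  { apply computable_comp2; auto with computable. apply computable_const. }
  (* This is the number of the program applying [d] to three constants. It ignores its own input, so
     halting on its own number just means that the search for [z] succeeds. *)
  exists (fun a b c => cpair 4 (cpair (enc d) (S (cpair (const_enc a)
    (S (cpair (const_enc b) (S (cpair (const_enc c) 0)))))))).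
  split; [intros A; prove_computable|].
  intros a b c. rewrite !const_enc_spec.
  set (e := cpair 4 _).
  assert (He : e = enc (CComp d [const_code a; const_code b; const_code c]))
    by reflexivity.
  clearbody e.
  assert (Hz : forall z, P z a b c <-> 1 - ind (P z a b c) = 0).
  { intros z. destruct (ind_cases (P z a b c)) as [[? ->]|[? ->]]; intuition lia. }
  specialize (Hd [a; b; c] eq_refl) as [Hd1 Hd2]. cbn [hd tl] in Hd1, Hd2.
  split.
  - intros (c' & Ec & v & Hv). rewrite He in Ec. apply enc_inj in Ec as ->.
    inversion Hv as [| | | | |? ? ? vs ? Hl Hf| | |]; subst.
    assert (vs = [a; b; c]) as ->.
    { repeat match goal with
             | H : eval_list _ _ _ _ |- _ => inversion H; subst; clear H
             end.
      repeat f_equal; eapply eval_deterministic; eauto using eval_const_code. }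
    exists v. apply Hz. auto.
  - intros [z H]. apply Hz in H. destruct (Hd1 z H) as (v & Hv & _).
    eexists. split; [symmetry; exact He|]. exists v.
    apply ev_comp with [a; b; c]; [|exact Hv].
    repeat constructor; apply eval_const_code.
Qed.

(** * Finite sets as bit masks *)

(** Written with division and remainder instead of [Nat.testbit] so that its computability is
    immediate. In this coding [N mod 2 ^ a] is the part of [N] below [a]. *)
Definition mem (N x : nat) : Prop := (N / 2 ^ x) mod 2 = 1.

Lemma mem_testbit N x : mem N x <-> Nat.testbit N x = true.
Proof. symmetry. apply Nat.testbit_true. Qed.

Lemma mem_ext N M : (forall x, mem N x <-> mem M x) -> N = M.
Proof.
  intros H. apply Nat.bits_inj. intros x. specialize (H x).
  rewrite !mem_testbit in H.
  destruct (Nat.testbit N x), (Nat.testbit M x); intuition congruence.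
Qed.

Lemma mem_pow2_le N x : mem N x -> 2 ^ x <= N.
Proof.
  unfold mem. intros H. destruct (Nat.le_gt_cases (2 ^ x) N) as [|L]; [assumption|].
  rewrite Nat.div_small in H by assumption. discriminate.
Qed.

Lemma mem_lt N a x : N < 2 ^ a -> mem N x -> x < a.
Proof.
  intros H Hx. apply mem_pow2_le in Hx.
  apply (Nat.pow_lt_mono_r_iff 2); lia.
Qed.

Lemma mem_log2 N : N <> 0 -> mem N (Nat.log2 N).
Proof. intros H. apply mem_testbit, Nat.bit_log2, H. Qed.

Lemma mem_mod N a x : mem (N mod 2 ^ a) x <-> mem N x /\ x < a.
Proof.
  rewrite !mem_testbit. destruct (Nat.lt_ge_cases x a) as [H|H].
  - rewrite Nat.mod_pow2_bits_low by assumption. tauto.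
  - rewrite Nat.mod_pow2_bits_high by assumption. split; [discriminate|lia].
Qed.

Lemma mod_pow2_lt N a : N mod 2 ^ a < 2 ^ a.
Proof. apply Nat.mod_upper_bound, Nat.pow_nonzero. discriminate. Qed.

(** All elements of [N] lie below [a], so the addition sets a fresh top bit without any carry. *)
Lemma mem_add N a x : N < 2 ^ a -> (mem (N + 2 ^ a) x <-> mem N x \/ x = a).
Proof.
  intros HN. pose proof (Nat.pow_nonzero 2 x ltac:(lia)) as Hx.
  destruct (Nat.lt_trichotomy x a) as [H|[->|H]].
  (* After division by [2 ^ x] with [x < a], the summand [2 ^ a] is even and leaves the parity
     alone. *)
  - unfold mem. replace (2 ^ a) with (2 ^ (a - S x) * 2 * 2 ^ x).
    + rewrite Nat.div_add by assumption. rewrite Nat.Div0.mod_add. intuition lia.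
    + rewrite <- Nat.mul_assoc. change (2 * 2 ^ x) with (2 ^ S x).
      rewrite <- Nat.pow_add_r. f_equal. lia.
  - split; [auto|intros _]. unfold mem.
    replace (N + 2 ^ a) with (N + 1 * 2 ^ a) by lia.
    rewrite Nat.div_add, Nat.div_small by assumption. reflexivity.
  - assert (N + 2 ^ a < 2 ^ x).
    { apply Nat.lt_le_trans with (2 ^ S a); [simpl; lia|].
      apply Nat.pow_le_mono_r; lia. }
    split.
    + intros Hm. apply mem_pow2_le in Hm. lia.
    + intros [Hm|]; [|lia]. apply mem_pow2_le in Hm. lia.
Qed.

Lemma mod_pow2_S_mem N a : mem N a -> N mod 2 ^ S a = N mod 2 ^ a + 2 ^ a.
Proof.
  intros H. apply mem_ext. intros x.
  rewrite mem_add, !mem_mod by apply mod_pow2_lt.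
  destruct (Nat.eq_dec x a) as [->|]; intuition lia.
Qed.

Lemma mod_pow2_S_not_mem N a : ~ mem N a -> N mod 2 ^ S a = N mod 2 ^ a.
Proof.
  intros H. apply mem_ext. intros x. rewrite !mem_mod.
  destruct (Nat.eq_dec x a) as [->|]; intuition lia.
Qed.

Lemma mod_pow2_mod N a b : a <= b -> (N mod 2 ^ b) mod 2 ^ a = N mod 2 ^ a.
Proof. intros H. apply mem_ext. intros x. rewrite !mem_mod. intuition lia. Qed.

Lemma mod_add_pow2 N a b : N < 2 ^ a -> b <= a -> (N + 2 ^ a) mod 2 ^ b = N mod 2 ^ b.
Proof.
  intros HN H. apply mem_ext. intros x. rewrite !mem_mod, mem_add by assumption.
  intuition lia.
Qed.

Lemma lt_pow2_diag n : n < 2 ^ n.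
Proof. apply Nat.pow_gt_lin_r. lia. Qed.

(** * Counting below a bound; sizes of finite sets *)

Definition cnt (n : nat) (P : nat -> Prop) : nat := bsum n (fun x => ind (P x)).

Lemma cnt_S n P : cnt (S n) P = ind (P n) + cnt n P.
Proof. reflexivity. Qed.

Lemma cnt_le n m P : n <= m -> cnt n P <= cnt m P.
Proof. induction 1; [auto|]. rewrite cnt_S. lia. Qed.

Lemma cnt_lt n m P : P n -> n < m -> cnt n P < cnt m P.
Proof.
  intros HP H. apply (cnt_le _ _ P) in H. rewrite cnt_S, ind_true in H by assumption. lia.
Qed.

Lemma cnt_ext n P Q : (forall x, x < n -> (P x <-> Q x)) -> cnt n P = cnt n Q.
Proof. intros H. apply bsum_ext. intros x Hx. apply ind_iff; auto. Qed.

Lemma cnt_stable a m P : a <= m -> (forall x, a <= x -> ~ P x) -> cnt m P = cnt a P.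
Proof.
  induction 1 as [|m Hm IH]; intros H; [reflexivity|].
  rewrite cnt_S, ind_false, IH; auto.
Qed.

(** The count is unbounded and grows in steps of at most one; the place where it passes from [v] to
    [S v] is an element. Thus any block of random bits is the index of some viable number. *)
Lemma cnt_onto P v : (forall m, exists z, m <= z /\ P z) -> exists z, P z /\ cnt z P = v.
Proof.
  intros H. destruct (classic (exists m, v < cnt m P)) as [[m Hm]|Hv].
  - induction m as [|m IH]; [unfold cnt in Hm; simpl in Hm; lia|].
    rewrite cnt_S in Hm. destruct (ind_cases (P m)) as [[HP E]|[HP E]]; rewrite E in Hm.
    + destruct (Nat.eq_dec (cnt m P) v); [now exists m|]. apply IH. lia.
    + apply IH. lia.
  - exfalso. assert (U : forall u, exists m, u <= cnt m P).
    { induction u as [|u [m Hu]]; [exists 0; lia|].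
      destruct (H m) as (z & Hz & HP). exists (S z).
      apply (cnt_le _ _ P) in Hz. rewrite cnt_S, ind_true by assumption. lia. }
    apply Hv. apply (U (S v)).
Qed.

(** The bound [N] suffices, since an element [x] satisfies [x < 2 ^ x <= N]. *)
Definition size (N : nat) : nat := cnt N (mem N).

Lemma size_eq N a : N < 2 ^ a -> size N = cnt a (mem N).
Proof.
  intros H. unfold size.
  assert (Hm : forall b, N < 2 ^ b -> forall x, b <= x -> ~ mem N x).
  { intros b Hb x Hx Hm. apply (mem_lt _ _ _ Hb) in Hm. lia. }
  destruct (Nat.le_ge_cases a N).
  - apply cnt_stable; [assumption|exact (Hm a H)].
  - symmetry. apply cnt_stable; [assumption|exact (Hm N (lt_pow2_diag N))].
Qed.

Lemma size_add N a : N < 2 ^ a -> size (N + 2 ^ a) = S (size N).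
Proof.
  intros H. rewrite (size_eq _ (S a)) by (simpl; lia).
  rewrite cnt_S, ind_true by (apply mem_add; auto).
  rewrite (size_eq N a H). simpl. f_equal. apply cnt_ext.
  intros x Hx. rewrite mem_add by assumption. intuition lia.
Qed.

Lemma size_mod_le N a : size (N mod 2 ^ a) <= size N.
Proof.
  rewrite (size_eq _ a) by apply mod_pow2_lt.
  transitivity (cnt (N + a) (mem N)).
  - transitivity (cnt a (mem N)); [|apply cnt_le; lia].
    apply Nat.eq_le_incl, cnt_ext. intros x Hx. rewrite mem_mod. tauto.
  - rewrite (size_eq N (N + a)); [lia|]. apply Nat.lt_le_trans with (2 ^ N).
    + apply lt_pow2_diag.
    + apply Nat.pow_le_mono_r; lia.
Qed.

Lemma size_mod_lt N a : mem N a -> size (N mod 2 ^ a) < size N.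
Proof.
  intros H. apply Nat.lt_le_trans with (size (N mod 2 ^ S a)); [|apply size_mod_le].
  rewrite mod_pow2_S_mem, size_add by (assumption || apply mod_pow2_lt). lia.
Qed.

Lemma size_le N : size N <= N.
Proof.
  unfold size. generalize (mem N) as P. intros P.
  induction N as [|N IH]; [unfold cnt; simpl; lia|]. rewrite cnt_S.
  destruct (ind_cases (P N)) as [[_ ->]|[_ ->]]; lia.
Qed.

Definition elements (N : nat) : list nat :=
  filter (fun x => Nat.testbit N x) (seq 0 N).

Lemma in_elements N x : mem N x -> In x (elements N).
Proof.
  intros H. apply filter_In. split; [|now apply mem_testbit].
  apply in_seq. apply mem_lt with (a := N) in H; [lia|apply lt_pow2_diag].
Qed.

Lemma length_elements N : length (elements N) = size N.
Proof.
  unfold elements, size. generalize N at 2 3 as n. induction n as [|n IH]; [reflexivity|].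
  rewrite seq_S, filter_app, length_app, IH, cnt_S. simpl.
  destruct (ind_cases (mem N n)) as [[H ->]|[H ->]]; rewrite mem_testbit in H;
    destruct (Nat.testbit N n); simpl; try lia; congruence.
Qed.

(** * Viable extensions of a rainbow *)

(** The bounds [S z] make viability decidable and lose nothing, as no element of [N + 2 ^ z] exceeds
    [z]. The condition [N < 2 ^ z] puts [z] above all of [N]. *)
Definition viable (F : nat -> nat -> nat -> nat) (i N z : nat) : Prop :=
  N < 2 ^ z /\
  forall x1, x1 < S z -> forall y1, y1 < S z ->
  forall x2, x2 < S z -> forall y2, y2 < S z ->
    mem (N + 2 ^ z) x1 -> mem (N + 2 ^ z) y1 ->
    mem (N + 2 ^ z) x2 -> mem (N + 2 ^ z) y2 ->
    x1 < y1 -> x2 < y2 -> F i x1 y1 = F i x2 y2 -> x1 = x2 /\ y1 = y2.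

Lemma viable_iff F i N z :
  viable F i N z <-> N < 2 ^ z /\ rainbow (F i) (mem (N + 2 ^ z)).
Proof.
  split; intros [HN H]; (split; [exact HN|]).
  - assert (Hm : forall x, mem (N + 2 ^ z) x -> x < S z).
    { intros x. apply mem_lt. simpl. lia. }
    intros x1 y1 x2 y2 m1 m2 m3 m4. apply H; auto.
  - intros x1 _ y1 _ x2 _ y2 _. apply H.
Qed.

Definition dead (F : nat -> nat -> nat -> nat) (i N : nat) : Prop :=
  exists m, forall z, m <= z -> ~ viable F i N z.

Lemma not_dead F i N : ~ dead F i N -> forall m, exists z, m <= z /\ viable F i N z.
Proof.
  intros H m. apply NNPP. intros H'. apply H. exists m. intros z Hz Hv.
  apply H'. eauto.
Qed.

Lemma empty_not_dead F i : ~ dead F i 0.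
Proof.
  intros [m H]. apply (H m (le_n m)), viable_iff.
  pose proof (Nat.pow_nonzero 2 m). split; [lia|].
  intros x1 y1 x2 y2 H1 H2 _ _ L. rewrite mem_add in H1, H2 by lia.
  assert (E : forall x, ~ mem 0 x).
  { intros x Hx. apply mem_pow2_le in Hx. pose proof (Nat.pow_nonzero 2 x). lia. }
  destruct H1 as [H1| ->], H2 as [H2| ->]; try (now apply E in H1); try (now apply E in H2).
  lia.
Qed.

(** Otherwise pairs of the color with ever larger second entries could be collected until there are
    [k + 1] of them. *)
Lemma color_bound k f : k_bounded k f ->
  forall col, exists B, forall x z, x < z -> f x z = col -> z < B.
Proof.
  intros Hk col. apply NNPP. intros H.
  assert (H' : forall B, exists x z, B <= z /\ x < z /\ f x z = col).
  { intros B. apply NNPP. intros HB. apply H. exists B. intros x z Hx E.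
    apply Nat.nle_gt. intros L. apply HB. eauto. }
  (* The bound [B] on second entries guarantees that the next pair is new. *)
  assert (E : forall n, exists P B, length P = n /\ NoDup P /\
    forall p, In p P -> snd p < B /\ fst p < snd p /\ f (fst p) (snd p) = col).
  { induction n as [|n (P & B & HP & ND & IH)].
    - exists [], 0. repeat split; [constructor| | |]; intros; contradiction.
    - destruct (H' B) as (x & z & Hz & Hx & E). exists ((x, z) :: P), (S z).
      repeat split; simpl; auto.
      + constructor; [|exact ND]. intros Hin. apply IH in Hin as [Hin _].
        simpl in Hin. lia.
      + destruct H0 as [<-|Hin]; simpl; [lia|]. apply IH in Hin. lia.
      + destruct H0 as [<-|Hin]; simpl; [lia|]. apply IH in Hin. lia.
      + destruct H0 as [<-|Hin]; simpl; [lia|]. apply IH in Hin. tauto. }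
  destruct (E (S k)) as (P & B & HP & ND & Hin).
  specialize (Hk col P ND). enough (length P <= k) by lia. apply Hk.
  intros p Hp. apply Hin in Hp. tauto.
Qed.

Lemma uniform_bound n (Q : nat -> nat -> Prop) :
  (forall p, p < n -> exists B, forall z, Q p z -> z < B) ->
  exists B, forall p z, p < n -> Q p z -> z < B.
Proof.
  induction n as [|n IH]; intros H; [exists 0; intros; lia|].
  destruct IH as [B1 H1]; [auto|]. destruct (H n) as [B2 H2]; [auto|].
  exists (B1 + B2). intros p z Hp Hz. destruct (Nat.eq_dec p n) as [->|].
  - apply H2 in Hz. lia.
  - apply H1 in Hz; lia.
Qed.

(** A sufficiently large new top element [z] therefore creates no collision with old pairs; only
    pairs that share the top [z] can collide. *)
Lemma color_bound_below k f : k_bounded k f -> forall C, exists B,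
  forall p q x z, p < C -> q < C -> x < z -> f x z = f p q -> z < B.
Proof.
  intros Hk C.
  destruct (uniform_bound C (fun p z => exists q x, q < C /\ x < z /\ f x z = f p q))
    as [B HB].
  - intros p _.
    destruct (uniform_bound C (fun q z => exists x, x < z /\ f x z = f p q)) as [B HB].
    + intros q _. destruct (color_bound k f Hk (f p q)) as [B HB]. exists B.
      intros z (x & Hx & E). eauto.
    + exists B. intros z (q & x & Hq & Hx & E). apply (HB q); eauto.
  - exists B. intros p q x z Hp Hq Hx E. apply (HB p); eauto.
Qed.

Lemma length_le_fibers (R : nat -> nat -> Prop) k D :
  (forall x l, NoDup l -> (forall a, In a l -> R a x) -> length l <= k) ->
  forall l, NoDup l -> (forall a, In a l -> exists x, In x D /\ R a x) ->
  length l <= length D * k.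
Proof.
  intros Hk. induction D as [|x D IH]; intros l ND H.
  - destruct l as [|a l]; [auto|]. destruct (H a (or_introl eq_refl)) as (x & [] & _).
  - set (b a := if excluded_middle_informative (R a x) then true else false).
    rewrite <- (filter_length b l). simpl. apply Nat.add_le_mono.
    + apply (Hk x); [now apply NoDup_filter|]. intros a Ha.
      apply filter_In in Ha as [_ Ha]. unfold b in Ha.
      now destruct excluded_middle_informative in Ha.
    + apply IH; [now apply NoDup_filter|]. intros a Ha.
      apply filter_In in Ha as [Ha Hb]. unfold b in Hb.
      destruct excluded_middle_informative as [|n] in Hb; [discriminate|].
      destruct (H a Ha) as (y & [<-|Hy] & HR); [contradiction|eauto].
Qed.

(* For large viable [z], a collision in [M + {a, z}] can only be between [(a, z)] and
   some [(x, z)] with [x] in [M], and each [x] accounts for at most [k] values of [a]. *)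
Lemma few_dead_extensions k F i M : k_bounded k (F i) -> ~ dead F i M ->
  forall l, NoDup l -> (forall a, In a l -> viable F i M a /\ dead F i (M + 2 ^ a)) ->
  length l <= size M * k.
Proof.
  intros Hk HM l ND Hl.
  (* [C] exceeds every element of [M] and of [l]. *)
  set (C := M + S (list_max l)).
  assert (HlC : forall a, In a l -> a < C).
  { intros a Ha. unfold C. pose proof (proj1 (list_max_le l (list_max l)) (le_n _)) as E.
    rewrite Forall_forall in E. apply E in Ha. lia. }
  assert (HMC : forall x, mem M x -> x < C).
  { intros x Hx. apply mem_lt with (a := M) in Hx; [unfold C; lia|apply lt_pow2_diag]. }
  destruct (color_bound_below k _ Hk C) as [B1 HB1].
  destruct (uniform_bound C (fun a z => In a l /\ viable F i (M + 2 ^ a) z)) as [B2 HB2].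
  { intros a _. destruct (classic (In a l)) as [Ha|Ha].
    - destruct (Hl a Ha) as [_ [m Hm]]. exists m. intros z [_ Hz].
      apply Nat.nle_gt. intros L. exact (Hm z L Hz).
    - exists 0. tauto. }
  (* Beyond [B1], pairs ending in [z] avoid the colors of pairs below [C]; beyond [B2], [z] is
     viable for no [M + 2 ^ a] with [a] in [l]. *)
  destruct (not_dead _ _ _ HM (B1 + B2 + C)) as (z & Hz & Hvz).
  apply viable_iff in Hvz as [HMz HRz].
  rewrite <- length_elements.
  apply (length_le_fibers (fun a x => a < z /\ F i a z = F i x z)); [|exact ND|].
  - intros x l' ND' H'. rewrite <- (length_map (fun a => (a, z)) l').
    apply (Hk (F i x z)).
    + apply (NoDup_map_inv fst). now rewrite map_map, map_id.
    + intros p Hp. apply in_map_iff in Hp as (a & <- & Ha). simpl. auto.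
  - intros a Ha. apply NNPP. intros Hno.
    assert (Haz : a < z) by (specialize (HlC a Ha); lia).
    destruct (Hl a Ha) as [Hva _]. apply viable_iff in Hva as [HMa HRa].
    assert (HMaz : M + 2 ^ a < 2 ^ z).
    { apply Nat.lt_le_trans with (2 ^ S a); [simpl; lia|].
      apply Nat.pow_le_mono_r; lia. }
    assert (Hno' : forall x, mem M x -> F i a z <> F i x z).
    { intros x Hx E. apply Hno. exists x. auto using in_elements. }
    (* If [(a, z)] collided with no [(x, z)], [x] in [M], then [z] would be viable for [M + 2 ^ a],
       although it lies beyond [B2]. *)
    enough (viable F i (M + 2 ^ a) z) by (enough (z < B2) by lia; eauto).
    apply viable_iff. split; [exact HMaz|].
    intros x1 y1 x2 y2 m1 m2 m3 m4 L1 L2 E.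
    assert (Hcases : forall x y, mem (M + 2 ^ a + 2 ^ z) x -> mem (M + 2 ^ a + 2 ^ z) y ->
      x < y -> (mem M x \/ x = a) /\ x < C /\ ((mem M y \/ y = a) /\ y < C \/ y = z)).
    { intros x y Hx Hy L. rewrite !mem_add in Hx, Hy by assumption.
      assert (x < C /\ (mem M x \/ x = a)) as [? ?].
      { destruct Hx as [[Hx|Hx]|Hx]; subst; auto. exfalso.
        destruct Hy as [[Hy|Hy]|Hy]; subst; try lia. apply HMC in Hy. lia. }
      repeat split; auto. destruct Hy as [[Hy|Hy]|Hy]; subst; auto. }
    destruct (Hcases x1 y1 m1 m2 L1) as (h1 & C1 & D1).
    destruct (Hcases x2 y2 m3 m4 L2) as (h2 & C2 & D2).
    (* Cases by whether each pair ends in [z]: both old pairs are settled by viability of [a], mixed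
       ones by [B1], and two pairs ending in [z] by viability of [z] or by [Hno']. *)
    destruct D1 as [[D1 E1]|D1], D2 as [[D2 E2]|D2].
    + apply HRa; auto; apply mem_add; auto.
    + subst y2. symmetry in E. apply HB1 in E; auto. lia.
    + subst y1. apply HB1 in E; auto. lia.
    + subst y1 y2. split; [|reflexivity].
      destruct h1 as [h1| ->], h2 as [h2| ->].
      * apply (HRz x1 z x2 z); auto; apply mem_add; auto.
      * symmetry in E. now apply Hno' in E.
      * now apply Hno' in E.
      * reflexivity.
Qed.

(** * Runs of the random construction *)

(** Closed form of the sum of the block lengths [2 * j' + 1 + q] over [j' < j]. *)
Definition offset (q j : nat) : nat := j * (j + q).

(* Step [j] reads the [offset q (S j) - offset q j = 2 j + 1 + q] bits of [w] that start
   at [offset q j]. *)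
Definition block (w q j : nat) : nat := (w / 2 ^ offset q j) mod 2 ^ (2 * j + 1 + q).

(* The set [N] is built by successively adding, to the current set [M], the viable
   element of [M] whose index is given by the block number [size M] of [w]. *)
Definition run (F : nat -> nat -> nat -> nat) (i q w N : nat) : Prop :=
  forall a, a < N -> mem N a ->
    viable F i (N mod 2 ^ a) a /\
    cnt a (viable F i (N mod 2 ^ a)) = block w q (size (N mod 2 ^ a)).

Lemma run_step F i q w N a : run F i q w N -> mem N a ->
  viable F i (N mod 2 ^ a) a /\
  cnt a (viable F i (N mod 2 ^ a)) = block w q (size (N mod 2 ^ a)).
Proof.
  intros H Ha. apply H; [|exact Ha]. apply mem_lt with (2 := Ha), lt_pow2_diag.
Qed.

Lemma run_empty F i q w : run F i q w 0.
Proof. intros a Ha. lia. Qed.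

Lemma offset_S q j : offset q (S j) = offset q j + (2 * j + 1 + q).
Proof. unfold offset. nia. Qed.

Lemma offset_le q j j' : j <= j' -> offset q j <= offset q j'.
Proof. unfold offset. nia. Qed.

Lemma mem_div N s x : mem (N / 2 ^ s) x <-> mem N (x + s).
Proof. now rewrite !mem_testbit, Nat.div_pow2_bits. Qed.

Lemma block_agree w w' t q j : w mod 2 ^ t = w' mod 2 ^ t -> offset q (S j) <= t ->
  block w q j = block w' q j.
Proof.
  intros E Ht. rewrite offset_S in Ht. apply mem_ext. intros x. unfold block.
  rewrite !mem_mod, !mem_div.
  pose proof (mem_mod w t (x + offset q j)) as H. rewrite E, mem_mod in H.
  assert (x < 2 * j + 1 + q -> x + offset q j < t) by lia. tauto.
Qed.

(** A use principle: a run to [N] consults only blocks numbered below [size N], hence only the first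
    [offset q (size N)] bits. *)
Lemma run_agree F i q w w' t N : w mod 2 ^ t = w' mod 2 ^ t -> offset q (size N) <= t ->
  run F i q w N -> run F i q w' N.
Proof.
  intros E Ht H a La Ha. destruct (H a La Ha) as [Hv Hc]. split; [exact Hv|].
  rewrite Hc. apply block_agree with t; [exact E|].
  etransitivity; [|exact Ht]. apply offset_le, size_mod_lt, Ha.
Qed.

Lemma run_mod F i q w N a : run F i q w N -> run F i q w (N mod 2 ^ a).
Proof.
  intros H b _ Hb. apply mem_mod in Hb as [Hb L].
  rewrite mod_pow2_mod by lia. now apply run_step.
Qed.

Lemma run_extend F i q w N a : run F i q w N -> viable F i N a ->
  cnt a (viable F i N) = block w q (size N) -> run F i q w (N + 2 ^ a).
Proof.
  intros H Hv Hc b _ Hb. pose proof (proj1 Hv) as HN.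
  apply mem_add in Hb; [|exact HN]. destruct Hb as [Hb| ->].
  - rewrite mod_add_pow2; [now apply run_step|exact HN|].
    apply (mem_lt _ _ _ HN) in Hb. lia.
  - rewrite mod_add_pow2, Nat.mod_small by auto. auto.
Qed.

(** The viability of the last element added already speaks about the whole set. *)
Lemma run_rainbow F i q w N : run F i q w N -> rainbow (F i) (mem N).
Proof.
  intros H. destruct (Nat.eq_dec N 0) as [->|HN].
  - intros x1 y1 x2 y2 Hx. apply mem_pow2_le in Hx. pose proof (Nat.pow_nonzero 2 x1). lia.
  - pose proof (mem_log2 N HN) as Hm.
    destruct (run_step _ _ _ _ _ _ H Hm) as [Hv _]. apply viable_iff in Hv as [_ Hv].
    rewrite <- mod_pow2_S_mem, Nat.mod_small in Hv; [exact Hv| |exact Hm].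
    apply Nat.log2_spec. lia.
Qed.

Lemma least_witness (P : nat -> Prop) n : P n ->
  exists m, m <= n /\ P m /\ forall x, x < m -> ~ P x.
Proof.
  induction n as [n IH] using lt_wf_ind. intros Hn.
  destruct (classic (exists x, x < n /\ P x)) as [(x & L & Hx)|H].
  - destruct (IH x L Hx) as (m & Lm & Hm). exists m. split; [lia|exact Hm].
  - exists n. repeat split; auto. intros x L Hx. apply H. eauto.
Qed.

(** At the first difference both runs have the same current set and read the same block. If [N']
    continued, it would choose some [b > a] of the same index as [a], but [a] itself is counted
    below [b]. *)
Lemma runs_do_not_diverge F i q w N N' a : run F i q w N -> run F i q w N' ->
  N mod 2 ^ a = N' mod 2 ^ a -> mem N a -> ~ mem N' a -> N' < 2 ^ a.
Proof.
  intros H H' E Ha Ha'. apply Nat.nle_gt. intros L.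
  pose proof (Nat.pow_nonzero 2 a ltac:(discriminate)).
  destruct (least_witness (fun x => a <= x /\ mem N' x) (Nat.log2 N'))
    as (b & _ & [Lb Hb] & Hmin).
  { split; [apply Nat.log2_le_pow2; lia|apply mem_log2; lia]. }
  assert (a <> b) by congruence.
  assert (Eb : N' mod 2 ^ b = N mod 2 ^ a).
  { rewrite E. apply mem_ext. intros x. rewrite !mem_mod. split; [|intuition lia].
    intros [Hx Lx]. split; [exact Hx|]. apply Nat.nle_gt. intros L'.
    exact (Hmin x Lx (conj L' Hx)). }
  destruct (run_step _ _ _ _ _ _ H Ha) as [Hv Hc].
  destruct (run_step _ _ _ _ _ _ H' Hb) as [_ Hc']. rewrite Eb, <- Hc in Hc'.
  pose proof (cnt_lt a b _ Hv ltac:(lia)). lia.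
Qed.

Lemma first_difference N N' x : ~ (mem N x <-> mem N' x) ->
  exists a, a <= x /\ N mod 2 ^ a = N' mod 2 ^ a /\ ~ (mem N a <-> mem N' a).
Proof.
  intros H.
  destruct (least_witness (fun y => ~ (mem N y <-> mem N' y)) x H)
    as (a & La & Ha & Hmin).
  exists a. repeat split; auto. apply mem_ext. intros y. rewrite !mem_mod.
  destruct (Nat.lt_ge_cases y a) as [L|L]; [|intuition lia].
  apply Hmin, NNPP in L. tauto.
Qed.

(** At a first difference one run must have stopped, yet both have elements at or above [x]. So any
    run that is large enough decides membership of [x] for good. *)
Lemma run_mem_below F i q w N N' x : run F i q w N -> run F i q w N' ->
  2 ^ x <= N -> mem N' x -> mem N x.
Proof.
  intros H H' L Hx. apply NNPP. intros Hn.
  destruct (first_difference N N' x) as (a & La & E & Ha); [tauto|].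
  pose proof (mem_pow2_le _ _ Hx) as L'.
  assert (2 ^ a <= 2 ^ x) by (apply Nat.pow_le_mono_r; lia).
  destruct (classic (mem N a)) as [h|h], (classic (mem N' a)) as [h'|h']; try tauto.
  - pose proof (runs_do_not_diverge _ _ _ _ _ _ _ H H' E h h'). lia.
  - pose proof (runs_do_not_diverge _ _ _ _ _ _ _ H' H (eq_sym E) h' h). lia.
Qed.

(** Of two different runs along the same bits one is a proper initial segment of the other, hence
    smaller. *)
Lemma run_size_inj F i q w N N' : run F i q w N -> run F i q w N' ->
  size N = size N' -> N = N'.
Proof.
  intros H H' Hs. apply mem_ext. intros x. apply NNPP. intros Hx.
  destruct (first_difference N N' x Hx) as (a & _ & E & Ha).
  assert (G : forall K K', run F i q w K -> run F i q w K' -> K mod 2 ^ a = K' mod 2 ^ a ->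
    mem K a -> ~ mem K' a -> size K' < size K).
  { intros K K' HK HK' EK h h'.
    pose proof (runs_do_not_diverge _ _ _ _ _ _ _ HK HK' EK h h') as L.
    rewrite <- (Nat.mod_small _ _ L), <- EK. now apply size_mod_lt. }
  destruct (classic (mem N a)) as [h|h], (classic (mem N' a)) as [h'|h']; try tauto.
  - specialize (G N N' H H' E h h'). lia.
  - specialize (G N' N H' H (eq_sym E) h' h). lia.
Qed.

(* The event that step [j] of the construction kills a set that was still alive. *)
Definition dies_at F i q j w : Prop :=
  exists M a, size M = j /\ M < 2 ^ a /\ run F i q w (M + 2 ^ a) /\
    ~ dead F i M /\ dead F i (M + 2 ^ a).

(** The empty set is alive, so there is a first dead initial segment of [N]; its last element does
    the killing. *)
Lemma dead_run_dies F i q w N : run F i q w N -> dead F i N ->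
  exists j, j < size N /\ dies_at F i q j w.
Proof.
  intros H HN.
  destruct (least_witness (fun a => dead F i (N mod 2 ^ a)) N) as (a & _ & Ha & Hmin).
  { now rewrite Nat.mod_small by apply lt_pow2_diag. }
  destruct a as [|a].
  { rewrite Nat.pow_0_r, Nat.mod_1_r in Ha. now apply empty_not_dead in Ha. }
  specialize (Hmin a (Nat.lt_succ_diag_r a)).
  assert (Hm : mem N a).
  { apply NNPP. intros h. now rewrite mod_pow2_S_not_mem in Ha. }
  exists (size (N mod 2 ^ a)). split; [now apply size_mod_lt|].
  exists (N mod 2 ^ a), a. rewrite <- mod_pow2_S_mem by exact Hm.
  auto using mod_pow2_lt, run_mod.
Qed.

Lemma dies_at_agree F i q j w w' :
  w mod 2 ^ offset q (S j) = w' mod 2 ^ offset q (S j) ->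
  dies_at F i q j w -> dies_at F i q j w'.
Proof.
  intros E (M & a & <- & L & H & Hd). exists M, a.
  split; [reflexivity|]. split; [exact L|]. split; [|exact Hd].
  apply (run_agree _ _ _ _ _ _ _ E); [|exact H]. now rewrite size_add.
Qed.

(** * Counting the bit sequences that kill a set *)

Lemma cnt_le_length n P m :
  (forall l, NoDup l -> (forall x, In x l -> x < n /\ P x) -> length l <= m) ->
  cnt n P <= m.
Proof.
  intros H.
  assert (E : exists l, NoDup l /\ (forall x, In x l -> x < n /\ P x) /\
    length l = cnt n P).
  { clear H. induction n as [|n (l & ND & Hl & E)].
    - exists []. repeat split; [constructor| |]; contradiction.
    - rewrite cnt_S. destruct (ind_cases (P n)) as [[HP ->]|[HP ->]].
      + exists (n :: l). repeat split; [|destruct H as [<-|H]; auto..|simpl; auto].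
        * constructor; [|exact ND]. intros Hn. apply Hl in Hn. lia.
        * apply Hl in H. lia.
        * now apply Hl.
      + exists l. repeat split; auto; apply Hl in H; [lia|tauto]. }
  destruct E as (l & ND & Hl & <-). auto.
Qed.

Lemma length_le_image (g : nat -> nat) (Q : nat -> Prop) m :
  (forall l, NoDup l -> (forall a, In a l -> Q a) -> length l <= m) ->
  forall l, NoDup l -> (forall v, In v l -> exists a, Q a /\ g a = v) -> length l <= m.
Proof.
  intros H l ND Hl.
  assert (E : exists l', map g l' = l /\ forall a, In a l' -> Q a).
  { clear - Hl. induction l as [|v l IH].
    - exists []. split; [reflexivity|contradiction].
    - destruct IH as (l' & <- & Hl'); [intros; apply Hl; now right|].
      destruct (Hl v (or_introl eq_refl)) as (a & Ha & <-).
      exists (a :: l'). split; [reflexivity|]. intros b [<-|Hb]; auto. }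
  destruct E as (l' & <- & Hl'). rewrite length_map. apply H; [|exact Hl'].
  now apply NoDup_map_inv in ND.
Qed.

Lemma cnt_app n m P : cnt (n + m) P = cnt n P + cnt m (fun x => P (n + x)).
Proof.
  induction m as [|m IH]; [rewrite Nat.add_0_r; unfold cnt at 3; simpl; lia|].
  rewrite Nat.add_succ_r, !cnt_S, IH. lia.
Qed.

Lemma bsum_add n f g : bsum n (fun x => f x + g x) = bsum n f + bsum n g.
Proof. induction n; simpl; lia. Qed.

Lemma bsum_le n f g : (forall x, x < n -> f x <= g x) -> bsum n f <= bsum n g.
Proof. induction n; simpl; intros H; [lia|]. apply Nat.add_le_mono; auto. Qed.

Lemma bsum_const n c : bsum n (fun _ => c) = n * c.
Proof. induction n; simpl; lia. Qed.

(** Numbers below [A * B] are split as [u + A * v]; for powers of two, [u] holds the earlier bits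
    and [v] the later ones. *)
Lemma cnt_mul A B P : cnt (A * B) P = bsum A (fun u => cnt B (fun v => P (u + A * v))).
Proof.
  induction B as [|B IH].
  - rewrite Nat.mul_0_r. unfold cnt. simpl. rewrite bsum_const. lia.
  - rewrite Nat.mul_succ_r, cnt_app, IH. unfold cnt at 3. simpl.
    rewrite bsum_add. rewrite Nat.add_comm. f_equal. unfold cnt. apply bsum_ext.
    intros x _. f_equal. f_equal. lia.
Qed.

(** For [A] a power of two: an event decided by the first bits keeps its probability when longer bit
    sequences are considered. *)
Lemma cnt_periodic A B P : (forall w w', w mod A = w' mod A -> P w -> P w') ->
  cnt (A * B) P = cnt A P * B.
Proof.
  intros H. induction B as [|B IH]; [rewrite !Nat.mul_0_r; reflexivity|].
  rewrite Nat.mul_succ_r, cnt_app, IH, Nat.mul_succ_r. f_equal. apply cnt_ext.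
  intros x _. replace (A * B + x) with (x + B * A) by lia.
  split; apply H; now rewrite Nat.Div0.mod_add.
Qed.

(** The bits [u] before block [j] determine the set [M] of size [j]. A killing value [v] of the
    block is the index of a dead extension of [M], and there are at most [j * k] of these. *)
Lemma cnt_dies_at_le k F i q j : k_bounded k (F i) ->
  cnt (2 ^ offset q (S j)) (dies_at F i q j) <= 2 ^ offset q j * (j * k).
Proof.
  intros Hk. rewrite offset_S, Nat.pow_add_r, cnt_mul.
  rewrite <- (bsum_const (2 ^ offset q j) (j * k)).
  apply bsum_le. intros u Hu. apply cnt_le_length.
  set (A := 2 ^ offset q j) in *. set (B := 2 ^ (2 * j + 1 + q)).
  assert (HA : A <> 0) by (apply Nat.pow_nonzero; discriminate).
  assert (Hrun : forall v, v < B -> dies_at F i q j (u + A * v) ->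
    exists M a, size M = j /\ run F i q u M /\ ~ dead F i M /\
      (viable F i M a /\ dead F i (M + 2 ^ a)) /\ cnt a (viable F i M) = v).
  { intros v Hv (M & a & Hj & L & H & Hd & Hd'). exists M, a.
    assert (HM : (M + 2 ^ a) mod 2 ^ a = M) by now rewrite mod_add_pow2, Nat.mod_small.
    assert (Ha : mem (M + 2 ^ a) a) by (apply mem_add; auto).
    destruct (run_step _ _ _ _ _ _ H Ha) as [Hva Hc].
    rewrite HM in Hva, Hc. rewrite Hj in Hc.
    split; [exact Hj|]. split; [|split; [exact Hd|split; [now split|]]].
    - apply (run_mod _ _ _ _ _ a) in H. rewrite HM in H.
      refine (run_agree _ _ _ _ _ (offset q j) _ _ _ H); [|now rewrite Hj].
      fold A. replace (u + A * v) with (u + v * A) by lia. apply Nat.Div0.mod_add.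
    - rewrite Hc. unfold block. fold A B. replace (u + A * v) with (u + v * A) by lia.
      rewrite Nat.div_add, (Nat.div_small u), Nat.mod_small by assumption. lia. }
  (* The first killing value provides [M]; all others lead to the same [M] by [run_size_inj]. *)
  intros [|v0 l] ND Hl; [simpl; lia|].
  destruct (Hl v0 (or_introl eq_refl)) as [L0 H0].
  destruct (Hrun v0 L0 H0) as (M & a0 & Hj & HM & Hd & _).
  rewrite <- Hj.
  apply length_le_image with (g := fun a => cnt a (viable F i M))
    (Q := fun a => viable F i M a /\ dead F i (M + 2 ^ a)).
  - exact (few_dead_extensions k F i M Hk Hd).
  - exact ND.
  - intros v Hv. apply Hl in Hv as [Lv Hv].
    destruct (Hrun v Lv Hv) as (M' & a & Hj' & HM' & _ & Ha & Hc).
    assert (M' = M) as -> by (apply (run_size_inj F i q u); (assumption || congruence)).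
    eauto.
Qed.

(** * The Martin-Löf test *)

(** In binary, [S (str_code s)] consists of the bits of [s], least significant first, topped by a
    leading 1. *)
Lemma mem_str_code s x : x < length s ->
  (mem (S (str_code s)) x <-> nth x s false = true).
Proof.
  revert x; induction s as [|b s IH]; intros x Hx; simpl in Hx; [lia|].
  assert (E : S (str_code (b :: s)) = 2 * S (str_code s) + (if b then 1 else 0))
    by (simpl; lia).
  rewrite E, mem_testbit. destruct x as [|x]; simpl nth.
  - destruct b; [rewrite Nat.testbit_odd_0|rewrite Nat.add_0_r, Nat.testbit_even_0]; tauto.
  - rewrite <- IH, mem_testbit by lia.
    destruct b; [rewrite Nat.testbit_odd_succ by lia|
      rewrite Nat.add_0_r, Nat.testbit_even_succ by lia]; tauto.
Qed.

Lemma str_code_bounds s : 2 ^ length s <= S (str_code s) < 2 ^ S (length s).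
Proof. induction s as [|[] s IH]; simpl in *; lia. Qed.

Lemma length_str_code s t :
  length s = t <-> 2 ^ t <= S (str_code s) /\ S (str_code s) < 2 ^ S t.
Proof.
  split; [intros <-; apply str_code_bounds|]. intros [H1 H2].
  pose proof (str_code_bounds s) as [H3 H4].
  destruct (Nat.lt_trichotomy (length s) t) as [L|[L|L]]; [|exact L|];
    apply (Nat.pow_le_mono_r 2) in L; lia.
Qed.

Lemma str_code_surj y : exists s, str_code s = y.
Proof.
  induction y as [y IH] using lt_wf_ind. destruct y as [|y]; [now exists []|].
  pose proof (Nat.div_mod_eq y 2) as E. pose proof (Nat.mod_upper_bound y 2).
  destruct (IH (y / 2)) as [s Hs]; [lia|].
  exists ((y mod 2 =? 1) :: s). cbn [str_code]. rewrite Hs.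
  destruct (Nat.eqb_spec (y mod 2) 1); lia.
Qed.

(** In the extra block length [k + c + i + 1], [k] absorbs the factor [k] in the number of bad
    choices, [c] gives the measure of the component, and [i + 1] makes the failures summable over
    the colorings. The length of [s] is exactly what the run may read, so the leading 1 of
    [S (str_code s)] is never read. *)
Definition rainbow_test F k c (s : list bool) : Prop :=
  exists i N, length s = offset (k + c + i + 1) (size N) /\
    run F i (k + c + i + 1) (S (str_code s)) N /\ dead F i N.

(** The cylinder of [s], on bit sequences coded as numbers. *)
Definition covers (s : list bool) (w : nat) : Prop :=
  w mod 2 ^ length s = S (str_code s) mod 2 ^ length s.

Lemma covers_nth s w x : covers s w -> x < length s ->
  (nth x s false = true <-> mem w x).
Proof.
  intros H Hx. rewrite <- mem_str_code by exact Hx.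
  pose proof (mem_mod w (length s) x) as H1. rewrite H, mem_mod in H1. tauto.
Qed.

Lemma covers_prefix s t w : covers s w -> covers t w -> length s <= length t ->
  is_prefix s t.
Proof.
  intros Hs Ht L. exists (skipn (length s) t).
  rewrite <- (firstn_skipn (length s) t) at 1. f_equal.
  apply nth_ext with false false; [apply firstn_length_le, L|].
  rewrite firstn_length_le by exact L. intros x Hx.
  rewrite nth_firstn. replace (x <? length s) with true by (symmetry; now apply Nat.ltb_lt).
  pose proof (covers_nth s w x Hs Hx). pose proof (covers_nth t w x Ht ltac:(lia)).
  destruct (nth x s false), (nth x t false); intuition congruence.
Qed.

Lemma cnt_covers s L : length s <= L -> 2 ^ (L - length s) <= cnt (2 ^ L) (covers s).
Proof.
  intros H. replace (2 ^ L) with (2 ^ length s * 2 ^ (L - length s))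
    by (rewrite <- Nat.pow_add_r; f_equal; lia).
  rewrite cnt_periodic by (unfold covers; congruence).
  set (v := S (str_code s) mod 2 ^ length s).
  pose proof (mod_pow2_lt (S (str_code s)) (length s)) as Hv. fold v in Hv.
  (* The residue [v] is itself covered, so each period contains at least one covered number. *)
  assert (cnt v (covers s) < cnt (2 ^ length s) (covers s)); [|nia].
  apply cnt_lt; [|exact Hv]. unfold covers. fold v. now apply Nat.mod_small.
Qed.

Lemma cnt_or_disjoint n P Q R : (forall w, P w -> Q w -> False) ->
  (forall w, P w \/ Q w -> R w) -> cnt n P + cnt n Q <= cnt n R.
Proof.
  intros Hd HR. induction n as [|n IH]; [unfold cnt; simpl; lia|]. rewrite !cnt_S.
  specialize (Hd n). specialize (HR n).
  destruct (ind_cases (P n)) as [[? ->]|[? ->]], (ind_cases (Q n)) as [[? ->]|[? ->]],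
    (ind_cases (R n)) as [[? ->]|[? ->]]; (lia || tauto).
Qed.

(** Prefix-free strings have disjoint cylinders, so their weights add up inside the union. *)
Lemma measure_le_cnt L G : NoDup G -> prefix_free G ->
  (forall s, In s G -> length s <= L) ->
  fold_right Nat.add 0 (map (fun s => 2 ^ (L - length s)) G) <=
  cnt (2 ^ L) (fun w => exists s, In s G /\ covers s w).
Proof.
  induction G as [|s G IH]; intros ND PF HL; simpl; [lia|].
  apply NoDup_cons_iff in ND as [Hs ND].
  etransitivity; [apply Nat.add_le_mono; [apply cnt_covers|apply IH]|].
  - apply HL; now left.
  - exact ND.
  - intros t t' Ht Ht'. apply PF; now right.
  - intros t Ht. apply HL; now right.
  - apply cnt_or_disjoint.
    + intros w Hw (t & Ht & Hw'). apply Hs.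
      destruct (Nat.le_ge_cases (length s) (length t)) as [L'|L'].
      * rewrite (PF s t); [exact Ht|now left|now right|]. eapply covers_prefix; eauto.
      * rewrite <- (PF t s); [exact Ht|now right|now left|]. eapply covers_prefix; eauto.
    + intros w [Hw|(t & Ht & Hw)]; eauto.
Qed.

Lemma cnt_union n m P (Q : nat -> nat -> Prop) :
  (forall w, P w -> exists i, i < m /\ Q i w) ->
  cnt n P <= bsum m (fun i => cnt n (Q i)).
Proof.
  intros H. induction n as [|n IH]; [unfold cnt; simpl; lia|].
  change (cnt (S n) P <= bsum m (fun i => ind (Q i n) + cnt n (Q i))).
  rewrite cnt_S, bsum_add. apply Nat.add_le_mono; [|exact IH].
  destruct (ind_cases (P n)) as [[HP ->]|[HP ->]]; [|lia].
  destruct (Nat.eq_0_gt_0_cases (bsum m (fun i => ind (Q i n)))) as [E|E]; [|lia].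
  rewrite bsum_ind_eq0 in E. destruct (H n HP) as (i & Hi & HQ). now apply E in HQ.
Qed.

Lemma bsum_mul_l c n f : c * bsum n f = bsum n (fun x => c * f x).
Proof. induction n; simpl; lia. Qed.

Lemma geometric_sum_le n a M : (forall i, i < n -> 2 ^ S i * a i <= M) -> bsum n a <= M.
Proof.
  (* The induction carries the sharper bound [M - M / 2 ^ n] on the sum, with denominators
     cleared. *)
  intros H. assert (E : 2 ^ n * bsum n a + M <= 2 ^ n * M).
  { induction n as [|n IH]; [simpl; lia|].
    specialize (IH (fun i Hi => H i (Nat.lt_lt_succ_r _ _ Hi))).
    specialize (H n (Nat.lt_succ_diag_r n)).
    cbn [bsum]. rewrite Nat.mul_add_distr_l.
    replace (2 ^ S n) with (2 * 2 ^ n) in * by reflexivity. lia. }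
  pose proof (Nat.pow_nonzero 2 n ltac:(discriminate)). nia.
Qed.

(** At most [j * k <= 2 ^ (j + k)] of the [2 ^ (2 * j + 1 + q)] block values kill, and
    [q = k + c + i + 1] makes the exponents cancel exactly. *)
Lemma dies_at_measure k F c i j L : k_bounded k (F i) ->
  offset (k + c + i + 1) (S j) <= L ->
  2 ^ S j * (2 ^ S i * (2 ^ c * cnt (2 ^ L) (dies_at F i (k + c + i + 1) j))) <= 2 ^ L.
Proof.
  intros Hk HL. set (q := k + c + i + 1) in *.
  replace (cnt (2 ^ L) (dies_at F i q j)) with
    (cnt (2 ^ offset q (S j)) (dies_at F i q j) * 2 ^ (L - offset q (S j))).
  2:{ rewrite <- cnt_periodic by apply dies_at_agree.
      f_equal. rewrite <- Nat.pow_add_r. f_equal. lia. }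
  pose proof (cnt_dies_at_le k F i q j Hk) as H.
  assert (Hjk : j * k <= 2 ^ j * 2 ^ k).
  { apply Nat.mul_le_mono; apply Nat.lt_le_incl, lt_pow2_diag. }
  assert (H' : cnt (2 ^ offset q (S j)) (dies_at F i q j) <=
    2 ^ (offset q j + j + k)).
  { rewrite !Nat.pow_add_r. nia. }
  transitivity (2 ^ S j * (2 ^ S i * (2 ^ c *
    (2 ^ (offset q j + j + k) * 2 ^ (L - offset q (S j)))))).
  - repeat apply Nat.mul_le_mono_l. now apply Nat.mul_le_mono_r.
  - rewrite <- !Nat.pow_add_r. apply Nat.pow_le_mono_r; [discriminate|].
    rewrite offset_S in *. lia.
Qed.

Lemma rainbow_test_measure k F c : (forall i, k_bounded k (F i)) ->
  measure_le_pow2 (rainbow_test F k c) c.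
Proof.
  intros Hk G L ND HG PF HL.
  (* Only steps whose bits fit into [L] matter; this forces [i < L] and [j < L], so the union bound
     is finite. *)
  pose (E i j w := offset (k + c + i + 1) (S j) <= L /\ dies_at F i (k + c + i + 1) j w).
  apply Nat.le_trans with
    (2 ^ c * bsum L (fun i => bsum L (fun j => cnt (2 ^ L) (E i j)))).
  - apply Nat.mul_le_mono_l. etransitivity; [apply measure_le_cnt; assumption|].
    etransitivity.
    + apply cnt_union with (m := L) (Q := fun i w => exists j, j < L /\ E i j w).
      intros w (s & Hs & Hw). destruct (HG s Hs) as (i & N & Hlen & Hrun & Hdead).
      apply (run_agree _ _ _ _ w (length s)) in Hrun; [|now symmetry|lia].
      destruct (dead_run_dies _ _ _ _ _ Hrun Hdead) as (j & Hj & Hd).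
      assert (HjL : offset (k + c + i + 1) (S j) <= L).
      { etransitivity; [apply (offset_le _ _ (size N)), Hj|].
        rewrite <- Hlen. apply HL, Hs. }
      assert (i < L /\ j < L) as [Hi HjL'] by (unfold offset in HjL; nia).
      exists i. split; [exact Hi|]. exists j. split; [exact HjL'|]. now split.
    + apply bsum_le. intros i Hi. apply cnt_union. auto.
  (* Two geometric sums, over the colorings [i] and over the steps [j]. *)
  - rewrite bsum_mul_l. apply geometric_sum_le. intros i _.
    rewrite !bsum_mul_l. apply geometric_sum_le. intros j _.
    destruct (classic (offset (k + c + i + 1) (S j) <= L)) as [Hle|Hle].
    + rewrite (cnt_ext _ (E i j) (dies_at F i (k + c + i + 1) j))
        by (unfold E; tauto).
      now apply dies_at_measure.
    + replace (cnt (2 ^ L) (E i j)) with 0; [lia|]. symmetry.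
      apply bsum_ind_eq0. unfold E. tauto.
Qed.

(** * Effectiveness of the test *)

Lemma computable_mem A : computable2 A (fun N x => ind (mem N x)).
Proof. unfold mem. prove_computable. Qed.
#[export] Hint Resolve computable_mem : computable.

Lemma computable_size A : computable1 A size.
Proof. unfold size, cnt. prove_computable. Qed.
#[export] Hint Resolve computable_size : computable.

Lemma computable_offset A : computable2 A offset.
Proof. unfold offset. prove_computable. Qed.
#[export] Hint Resolve computable_offset : computable.

Lemma computable_block A : computable3 A block.
Proof. unfold block. prove_computable. Qed.
#[export] Hint Resolve computable_block : computable.

Lemma computable_viable A F : computable3 A F ->
  computable3 A (fun i N z => ind (viable F i N z)).
Proof. intros HF. unfold viable. prove_computable. Qed.
#[export] Hint Resolve computable_viable : computable.

Lemma computable_run A F : computable3 A F ->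
  computable4 A (fun i q w N => ind (run F i q w N)).
Proof. intros HF. unfold run, cnt. prove_computable. Qed.
#[export] Hint Resolve computable_run : computable.

Lemma computable_coloring_seq_any_oracle F A :
  computable_coloring_seq F -> computable3 A F.
Proof.
  intros [c Hc]. exists (strip_oracle c).
  intros [|i [|x [|y [|]]]]; try discriminate. intros _. apply eval_strip_oracle, Hc.
Qed.

(** Deadness says that for some [b] the search for a viable [z >= b] never halts, which the halting
    set decides for each [b]. A search for all witnesses at once then enumerates the test. *)
Lemma rainbow_test_ce k F : computable_coloring_seq F ->
  ce_in halting_set
    (fun m => exists c s, m = cpair c (str_code s) /\ rainbow_test F k c s).
Proof.
  intros HF'.
  assert (HF : forall A, computable3 A F)
    by (intros A; now apply computable_coloring_seq_any_oracle).
  destruct (halting_query (fun z i N b => b <= z /\ viable F i N z)) as (h & Hh & Hhalt).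
  { prove_computable. }
  assert (Hdead : forall i N, dead F i N <-> exists b, ~ halting_set (h i N b)).
  { intros i N. split; intros [b Hb]; exists b.
    - rewrite Hhalt. intros (z & Lz & Hz). exact (Hb z Lz Hz).
    - intros z Lz Hz. apply Hb, Hhalt. eauto. }
  (* One number [t] bounds all witnesses. The string is replaced by its code [y], and its length is
     expressed by the two inequalities on [S y]. *)
  pose (Q := fun t m => exists c, c < t /\ exists y, y < t /\ exists i, i < t /\
    exists N, N < t /\ exists b, b < t /\
      m = cpair c y /\ 2 ^ offset (k + c + i + 1) (size N) <= S y /\
      S y < 2 ^ S (offset (k + c + i + 1) (size N)) /\
      run F i (k + c + i + 1) (S y) N /\ ~ halting_set (h i N b)).
  destruct (eval_mu_total halting_set 1
    (fun l => 1 - ind (Q (hd 0 l) (hd 0 (tl l))))) as [d Hd].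
  { unfold Q. prove_computable. }
  exists d. intros m. specialize (Hd [m] eq_refl) as [Hd1 Hd2]. cbn [hd tl] in Hd1, Hd2.
  assert (HQ : forall t, 1 - ind (Q t m) = 0 <-> Q t m).
  { intros t. destruct (ind_cases (Q t m)) as [[? ->]|[? ->]]; intuition lia. }
  transitivity (exists t, Q t m).
  - split.
    + intros (c & s & -> & i & N & Hlen & Hrun & HN).
      apply Hdead in HN as [b Hb]. apply length_str_code in Hlen as [L1 L2].
      exists (S (c + str_code s + i + N + b)).
      exists c. split; [lia|]. exists (str_code s). split; [lia|].
      exists i. split; [lia|]. exists N. split; [lia|]. exists b. split; [lia|]. auto.
    + intros (t & c & _ & y & _ & i & _ & N & _ & b & _ & -> & L1 & L2 & Hrun & Hb).
      destruct (str_code_surj y) as [s <-]. exists c, s. split; [reflexivity|].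
      exists i, N. split; [|split; [exact Hrun|]].
      * apply length_str_code. auto.
      * apply Hdead. eauto.
  - split.
    + intros [t Ht]. apply HQ in Ht. destruct (Hd1 t Ht) as (v & Hv & _). eauto.
    + intros [v Hv]. exists v. apply HQ. auto.
Qed.

(** * The rainbow computed from a random set *)

Definition set_bits (X : nat -> Prop) (T : nat) : nat :=
  bsum T (fun b => ind (X b) * 2 ^ b).

Lemma computable_set_bits X : computable1 X (set_bits X).
Proof. unfold set_bits. prove_computable. Qed.
#[export] Hint Resolve computable_set_bits : computable.

Lemma mem_set_bits X T x : mem (set_bits X T) x <-> X x /\ x < T.
Proof.
  (* The bound is carried along because [mem_add] requires it in the induction. *)
  enough (set_bits X T < 2 ^ T /\ (mem (set_bits X T) x <-> X x /\ x < T)) by tauto.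
  induction T as [|T [L IH]].
  - split; [unfold set_bits; simpl; lia|]. split; [|lia].
    intros H. apply mem_pow2_le in H. pose proof (Nat.pow_nonzero 2 x).
    unfold set_bits in H. simpl in H. lia.
  - change (set_bits X (S T)) with (ind (X T) * 2 ^ T + set_bits X T).
    rewrite Nat.pow_succ_r'.
    destruct (ind_cases (X T)) as [[HT ->]|[HT ->]].
    + rewrite Nat.mul_1_l, Nat.add_comm. split; [lia|].
      rewrite mem_add, IH by exact L.
      destruct (Nat.eq_dec x T) as [->|]; intuition lia.
    + simpl. split; [lia|]. rewrite IH.
      destruct (Nat.eq_dec x T) as [->|]; intuition lia.
Qed.

Lemma set_bits_mod X t T : t <= T -> set_bits X T mod 2 ^ t = set_bits X t.
Proof.
  intros H. apply mem_ext. intros x. rewrite mem_mod, !mem_set_bits. intuition lia.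
Qed.

Lemma prefix_string X t : exists s, length s = t /\ prefix_of_set s X /\
  S (str_code s) mod 2 ^ t = set_bits X t.
Proof.
  set (b := fun x => if excluded_middle_informative (X x) then true else false).
  set (s := map b (seq 0 t)).
  assert (Hs : length s = t) by (unfold s; now rewrite length_map, length_seq).
  assert (Hn : forall x, x < t -> (nth x s false = true <-> X x)).
  { intros x Hx. unfold s. rewrite nth_indep with (d' := b 0)
      by (rewrite length_map, length_seq; exact Hx).
    rewrite map_nth, seq_nth by exact Hx. simpl. unfold b.
    destruct excluded_middle_informative; intuition congruence. }
  exists s. split; [exact Hs|]. split.
  - intros x Hx. apply Hn. lia.
  - apply mem_ext. intros x. rewrite mem_mod, mem_set_bits.
    destruct (Nat.lt_ge_cases x t) as [L|L]; [|intuition lia].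
    rewrite mem_str_code, Hn by lia. tauto.
Qed.

(** Since [size N <= N], the first [offset q N] bits of [X] cover everything the run reads, and this
    number of bits is computed from [N] alone. *)
Definition run_along X F i q N : Prop := run F i q (set_bits X (offset q N)) N.

Lemma run_along_at X F i q T N : N <= T -> run_along X F i q N ->
  run F i q (set_bits X (offset q T)) N.
Proof.
  intros H. apply run_agree with (t := offset q (size N)); [|reflexivity].
  rewrite !set_bits_mod; [reflexivity|apply offset_le..].
  - pose proof (size_le N). lia.
  - apply size_le.
Qed.

Lemma run_along_of_run X F i q T N : offset q (size N) <= T ->
  run F i q (set_bits X T) N -> run_along X F i q N.
Proof.
  intros H. apply run_agree with (t := offset q (size N)); [|reflexivity].
  rewrite !set_bits_mod; [reflexivity|apply offset_le, size_le|exact H].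
Qed.

(** Otherwise the prefix of [X] read by the run would belong to the test component that [X]
    avoids. *)
Lemma run_along_not_dead X F k c i N :
  (forall s, rainbow_test F k c s -> ~ prefix_of_set s X) ->
  run_along X F i (k + c + i + 1) N -> ~ dead F i N.
Proof.
  intros HX H Hd. set (q := k + c + i + 1) in *.
  destruct (prefix_string X (offset q (size N))) as (s & Hs & Hp & E).
  apply (HX s); [|exact Hp]. exists i, N. fold q. split; [exact Hs|]. split; [|exact Hd].
  revert H. apply run_agree with (t := offset q (size N)); [|reflexivity].
  rewrite E. apply set_bits_mod, offset_le, size_le.
Qed.

Lemma run_along_unbounded X F k c i :
  (forall s, rainbow_test F k c s -> ~ prefix_of_set s X) ->
  forall m, exists N, m <= N /\ run_along X F i (k + c + i + 1) N.
Proof.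
  intros HX. set (q := k + c + i + 1).
  induction m as [|m (N & Hm & HN)]; [exists 0; split; [lia|apply run_empty]|].
  pose proof (not_dead _ _ _ (run_along_not_dead _ _ _ _ _ _ HX HN)) as Hv.
  (* The extended set has at most [S N] elements, so [offset q T] bits include the next block. *)
  set (T := S N).
  destruct (cnt_onto _ (block (set_bits X (offset q T)) q (size N)) Hv) as (a & Ha & Hc).
  exists (N + 2 ^ a). pose proof (Nat.pow_nonzero 2 a ltac:(discriminate)). split; [lia|].
  apply run_along_of_run with (offset q T).
  - apply offset_le. rewrite size_add by apply Ha. pose proof (size_le N). lia.
  - apply run_extend; auto. apply run_along_at; [lia|exact HN].
Qed.

Lemma run_along_mem_below X F i q N N' x : run_along X F i q N -> run_along X F i q N' ->
  2 ^ x <= N -> mem N' x -> mem N x.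
Proof.
  intros H H'. apply run_mem_below with (F := F) (i := i) (q := q)
    (w := set_bits X (offset q (N + N'))); apply run_along_at; (lia || assumption).
Qed.

Theorem theorem6p4 (k : nat) (X : nat -> Prop) :
  1 <= k -> two_random X ->
  forall F : nat -> nat -> nat -> nat,
    computable_coloring_seq F ->
    (forall i, k_bounded k (F i)) ->
    exists S : nat -> nat -> Prop,
      set_seq_computable_in X S /\
      forall i, infinite_set (S i) /\ rainbow (F i) (S i).
Proof.
  intros _ HX F HF Hk.
  (* Here [c] is the component avoided by [X]; the same [c] serves all colorings, which makes the
     sequence uniform. *)
  destruct (HX (rainbow_test F k)) as [c Hc].
  { split; [now apply rainbow_test_ce|]. intros c. now apply rainbow_test_measure. }
  pose proof (computable_coloring_seq_any_oracle F X HF) as HFX.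
  pose proof (fun i => run_along_unbounded X F k c i Hc) as Hunb.
  set (R := fun i => run_along X F i (k + c + i + 1)) in *.
  (* Each rainbow is the union of all runs along [X]. *)
  exists (fun i x => exists N, R i N /\ mem N x). split.
  (* To decide [x], search for a run [N] with [2 ^ x <= N]; it exists by [Hunb], and its bit [x] is
     final by [run_along_mem_below]. *)
  - destruct (eval_mu_total X 2 (fun l => 1 - ind (2 ^ hd 0 (tl (tl l)) <= hd 0 l /\
      R (hd 0 (tl l)) (hd 0 l)))) as [d Hd].
    { unfold R, run_along. prove_computable. }
    destruct (computable_mem X) as [e He].
    exists (CComp e [d; CProj 1]). intros i x.
    specialize (Hd [i; x] eq_refl) as [Hd _]. cbn [hd tl] in Hd.
    destruct (Hunb i (2 ^ x)) as (N0 & L0 & H0).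
    destruct (Hd N0) as (N & HN & E); [now rewrite ind_true|].
    destruct (ind_cases (2 ^ x <= N /\ R i N)) as [[[L HR] _]|[_ E']]; [|lia].
    assert (Hev : eval X (CComp e [d; CProj 1]) [i; x] (ind (mem N x))).
    { apply ev_comp with [N; x]; [|exact (He [N; x] eq_refl)].
      constructor; [exact HN|]. constructor; [apply (ev_proj X 1 [i; x])|constructor]. }
    split; intros H.
    + rewrite ind_true in Hev; [exact Hev|]. destruct H as (N' & HR' & Hm).
      exact (run_along_mem_below _ _ _ _ _ _ _ HR HR' L Hm).
    + rewrite ind_false in Hev; [exact Hev|]. intros Hm. apply H. eauto.
  - intros i. split.
    + intros m. destruct (Hunb i (2 ^ m)) as (N & L & HR).
      pose proof (Nat.pow_nonzero 2 m ltac:(discriminate)).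
      exists (Nat.log2 N). split; [apply Nat.log2_le_pow2; lia|].
      exists N. split; [exact HR|]. apply mem_log2. lia.
    + intros x1 y1 x2 y2 (N1 & R1 & m1) (N2 & R2 & m2) (N3 & R3 & m3) (N4 & R4 & m4).
      (* A single run this large contains all four points, so its being a rainbow suffices. *)
      destruct (Hunb i (2 ^ (x1 + y1 + x2 + y2))) as (N & L & HR).
      assert (Hm : forall x N', x <= x1 + y1 + x2 + y2 -> R i N' -> mem N' x -> mem N x).
      { intros x N' Hx HR' Hm. refine (run_along_mem_below _ _ _ _ _ _ _ HR HR' _ Hm).
        etransitivity; [|exact L]. apply Nat.pow_le_mono_r; lia. }
      apply (run_rainbow _ _ _ _ _ HR).
      * exact (Hm x1 N1 ltac:(lia) R1 m1).
      * exact (Hm y1 N2 ltac:(lia) R2 m2).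
      * exact (Hm x2 N3 ltac:(lia) R3 m3).
      * exact (Hm y2 N4 ltac:(lia) R4 m4).
Qed.
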